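(* Let $\mathcal I=\langle n,D,D_0,H,V,M,D_{acc}\rangle$ be an instance of the alternating multi-tiling problem and $AP=D\cup(\{r,c\}\times\{0,1\})\cup\{\bot,\mathit{end}\}$. One can construct, in time polynomial in the size of $\mathcal I$, a finite Kripke structure $K_{\mathcal I}$ and a $\mathsf{B}\overline{\mathsf{E}}$ formula $\varphi_{\mathcal I}$ over $AP$ such that $K_{\mathcal I}\models\varphi_{\mathcal I}$ iff $\mathcal I$ is a positive instance of the alternating multi-tiling problem.
   Context: An instance of the alternating multi-tiling problem is $\mathcal I=\langle n,D,D_0,H,V,M,D_{acc}\rangle$: $n$ a positive even natural number given in unary, $D$ a nonempty finite set of domino types, $D_0\subseteq D$ initial domino types, $H,V\subseteq D\times D$ horizontal and vertical matching relations, $M\subseteq D\times D$ multi-tiling matching relation, $D_{acc}\subseteq D$ accepting types. A tiling is a map $f:[0,2^n-1]\times[0,2^n-1]\to D$ with $(f(i,j),f(i,j+1))\in H$ whenever $j<2^n-1$ and $(f(i,j),f(i+1,j))\in V$ whenever $i<2^n-1$; $\mathrm{Init}(f)=f(0,0)f(0,1)\cdots f(0,2^n-1)$. A multi-tiling is a tuple $\langle f_1,\dots,f_n\rangle$ of tilings such that $(f_\ell(i,j),f_{\ell+1}(i,j))\in M$ for all $i,j$ and $\ell\in[1,n-1]$, and $f_n(2^n-1,j)\in D_{acc}$ for some $j$. $\mathcal I$ is positive iff $\forall w_1\in D_0^{2^n}\,\exists w_2\in D_0^{2^n}\cdots\forall w_{n-1}\in D_0^{2^n}\,\exists w_n\in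 D_0^{2^n}$ there is a multi-tiling $\langle f_1,\dots,f_n\rangle$ with $\mathrm{Init}(f_i)=w_i$ for all $i$. Kripke structures $K=(AP,S,R,\mu,s_0)$, traces (nonempty finite $R$-paths $\rho$ over $S$; initial if $\rho(1)=s_0$), $\mu(\rho)$ the induced word over $2^{AP}$, $\mathrm{Pref}(\rho)$/$\mathrm{Suff}(\rho)$ the proper nonempty prefixes/suffixes. Regular expressions over $AP$: $r::=\varepsilon\mid\phi\mid r\cup r\mid r\cdot r\mid r^*$, $\phi$ propositional over $AP$. $\mathsf{B}\overline{\mathsf{E}}$ formulas: $\psi::=r\mid\neg\psi\mid\psi\wedge\psi\mid\langle B\rangle\psi\mid\langle\overline E\rangle\psi$ with $[X]\psi:=\neg\langle X\rangle\neg\psi$; $K,\rho\models r$ iff $\mu(\rho)\in\mathcal L(r)$; $K,\rho\models\langle B\rangle\psi$ iff $K,\rho'\models\psi$ for some $\rho'\in\mathrm{Pref}(\rho)$; $K,\rho\models\langle\overline E\rangle\psi$ iff $K,\rho'\models\psi$ for some trace $\rho'$ of $K$ with $\rho\in\mathrm{Suff}(\rho')$. $K\models\varphi$ iff every initial trace of $K$ satisfies $\varphi$. *)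

(* Defs.v *)
From mathcomp Require Import all_boot.

Set Implicit Arguments.
Unset Strict Implicit.
Unset Printing Implicit Defensive.

Record instance := Instance {
  idim : nat;
  idim_gt0 : 0 < idim;
  idim_even : ~~ odd idim;
  idom : finType;
  idom_gt0 : 0 < #|idom|;
  iinit : {set idom};
  ihor : {set idom * idom};
  iver : {set idom * idom};
  imulti : {set idom * idom};
  iacc : {set idom}
}.

Lemma expn2_gt0 n : 0 < 2 ^ n.
Proof. by rewrite expn_gt0. Qed.

Definition pos_first n : 'I_(2 ^ n) := Ordinal (expn2_gt0 n).
Definition pos_last n : 'I_(2 ^ n) := rev_ord (pos_first n).

Section Tilings.

Variable I : instance.
Local Notation n := (idim I).
Local Notation D := (idom I).
Local Notation pos := 'I_(2 ^ n).

Definition grid_map := {ffun pos * pos -> D}.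

Definition tiling (f : grid_map) : Prop :=
  (forall i j j' : pos, j' = j.+1 :> nat -> (f (i, j), f (i, j')) \in ihor I) /\
  (forall i i' j : pos, i' = i.+1 :> nat -> (f (i, j), f (i', j)) \in iver I).

Definition Init (f : grid_map) : (2 ^ n).-tuple D :=
  [tuple f (pos_first n, j) | j < 2 ^ n].

Definition multi_tiling (fs : n.-tuple grid_map) : Prop :=
  [/\ forall l : 'I_n, tiling (tnth fs l),
      forall l l' : 'I_n, l' = l.+1 :> nat ->
        forall i j : pos, (tnth fs l (i, j), tnth fs l' (i, j)) \in imulti I
    & forall l : 'I_n, l.+1 = n ->
        exists j : pos, tnth fs l (pos_last n, j) \in iacc I].

End Tilings.

(* [alternate P b m Q] is Q1 x_1 in P, ..., Qm x_m in P, Q [:: x_1; ...; x_m],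
   with alternating quantifiers, Q1 being universal iff [b]. *)
Fixpoint alternate (T : Type) (P : pred T) (b : bool) (m : nat)
    (Q : seq T -> Prop) : Prop :=
  if m is m'.+1 then
    if b then
      forall x, P x -> alternate P false m' (fun xs => Q (x :: xs))
    else
      exists x, P x /\ alternate P true m' (fun xs => Q (x :: xs))
  else Q [::].

Definition positive (I : instance) : Prop :=
  alternate (fun w : (2 ^ idim I).-tuple (idom I) => all (mem (iinit I)) w)
    true (idim I)
    (fun ws => exists fs : (idim I).-tuple (grid_map I),
       multi_tiling fs /\ [seq Init f | f <- fs] = ws).

Record kripke (AP : finType) := Kripke {
  kstate : finType;
  ktrans : {set kstate * kstate};
  klabel : kstate -> {set AP};
  kinit : kstate
}.

Inductive pform (AP : Type) :=
  | PTrue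
  | PAtom of AP
  | PNot of pform AP
  | PAnd of pform AP & pform AP
  | POr of pform AP & pform AP.

Inductive regexp (AP : Type) :=
  | REps
  | RProp of pform AP
  | RUnion of regexp AP & regexp AP
  | RCat of regexp AP & regexp AP
  | RStar of regexp AP.

Inductive form (AP : Type) :=
  | FReg of regexp AP
  | FNot of form AP
  | FAnd of form AP & form AP
  | FB of form AP
  | FEbar of form AP.

Arguments PTrue {AP}.
Arguments REps {AP}.

Section Semantics.

Variable AP : finType.

Fixpoint psat (A : {set AP}) (f : pform AP) : bool :=
  match f with
  | PTrue => true
  | PAtom p => p \in A
  | PNot g => ~~ psat A g
  | PAnd g h => psat A g && psat A h
  | POr g h => psat A g || psat A h
  end.

Fixpoint lang (r : regexp AP) (w : seq {set AP}) : Prop :=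
  match r with
  | REps => w = [::]
  | RProp f => exists A, w = [:: A] /\ psat A f
  | RUnion r1 r2 => lang r1 w \/ lang r2 w
  | RCat r1 r2 => exists w1 w2, [/\ w = w1 ++ w2, lang r1 w1 & lang r2 w2]
  | RStar r1 => exists ws, w = flatten ws /\ (forall v, v \in ws -> lang r1 v)
  end.

Variable K : kripke AP.

Definition trace (rho : seq (kstate K)) : bool :=
  if rho is s :: rho' then path [rel s t | (s, t) \in ktrans K] s rho'
  else false.

Definition initial_trace (rho : seq (kstate K)) : bool :=
  trace rho && (ohead rho == Some (kinit K)).

Definition Pref (rho : seq (kstate K)) : pred (seq (kstate K)) :=
  fun rho' => [&& rho' != [::], rho' != rho & prefix rho' rho].
Definition Suff (rho : seq (kstate K)) : pred (seq (kstate K)) :=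
  fun rho' => [&& rho' != [::], rho' != rho & suffix rho' rho].

Fixpoint sat (rho : seq (kstate K)) (psi : form AP) : Prop :=
  match psi with
  | FReg r => lang r [seq klabel s | s <- rho]
  | FNot psi1 => ~ sat rho psi1
  | FAnd psi1 psi2 => sat rho psi1 /\ sat rho psi2
  | FB psi1 => exists rho', Pref rho rho' /\ sat rho' psi1
  | FEbar psi1 => exists rho', [/\ trace rho', Suff rho' rho & sat rho' psi1]
  end.

Definition models (psi : form AP) : Prop :=
  forall rho, initial_trace rho -> sat rho psi.

End Semantics.

(* D, plus {r,c} x {0,1} with r and c coded by [false] and [true], plus
   {bot, end}, again coded by [bool]; the union is disjoint. *)
Definition AP_of (D : finType) : finType := (D + (bool * bool) + bool)%type.

(* A Turing-complete language of programs computing on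
   S-expressions with one kind of atom (binary trees). *)
Inductive tree := Leaf | Node of tree & tree.

Fixpoint tsize (t : tree) : nat :=
  if t is Node a b then (tsize a + tsize b).+1 else 1.

Definition thead (t : tree) : tree := if t is Node a _ then a else Leaf.
Definition ttail (t : tree) : tree := if t is Node _ b then b else Leaf.

Inductive prog :=
  | Id
  | Nil
  | Hd
  | Tl
  | Pair of prog & prog
  | Comp of prog & prog            (* [Comp p q] runs [q], then [p] *)
  | If of prog & prog & prog
  | While of prog & prog.          (* [While c p]: condition [c], body [p] *)

(* [run p x y t]: on input [x], [p] halts with output [y] in time [t].
   [Leaf] is false, any [Node] is true. Every instruction is charged at least
   the sizes of the trees it reads and of the tree it builds (no sharing of
   subtrees for free), so that [t] agrees with the running time of a
   multi-tape Turing machine up to a polynomial, and bounds the size of the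
   output. *)
Inductive run : prog -> tree -> tree -> nat -> Prop :=
  | RunId x : run Id x x (tsize x)
  | RunNil x : run Nil x Leaf (tsize x)
  | RunHd x : run Hd x (thead x) (tsize x)
  | RunTl x : run Tl x (ttail x) (tsize x)
  | RunPair p q x a b s t :
      run p x a s -> run q x b t ->
      run (Pair p q) x (Node a b) (s + t + tsize (Node a b))
  | RunComp p q x y z s t :
      run q x y s -> run p y z t -> run (Comp p q) x z (s + t)
  | RunIfTrue c p q x a b y s t :
      run c x (Node a b) s -> run p x y t -> run (If c p q) x y (s + t)
  | RunIfFalse c p q x y s t :
      run c x Leaf s -> run q x y t -> run (If c p q) x y (s + t)
  | RunWhileStop c p x s :
      run c x Leaf s -> run (While c p) x x s
  | RunWhileStep c p x a b y z s t u :
      run c x (Node a b) s -> run p x y t -> run (While c p) y z u ->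
      run (While c p) x z (s + t + u).

Definition polytime (A : Type) (B : A -> Type) (encA : A -> tree)
    (encB : forall a, B a -> tree) (g : forall a, B a) : Prop :=
  exists (p : prog) (c k : nat), forall a : A,
    exists t, run p (encA a) (encB a (g a)) t /\ t <= c * tsize (encA a) ^ k + c.

(* Numbers, and elements of a finite type given by their rank, are in unary. *)
Definition enc_nat (m : nat) : tree := iter m (Node Leaf) Leaf.
Definition enc_list (s : seq tree) : tree := foldr Node Leaf s.
Definition enc_fin (T : finType) (x : T) : tree := enc_nat (enum_rank x).
Definition enc_set (T : finType) (A : {set T}) : tree :=
  enc_list [seq enc_fin x | x <- enum A].
Definition enc_rel (T : finType) (A : {set T * T}) : tree :=
  enc_list [seq Node (enc_fin x.1) (enc_fin x.2) | x <- enum A].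

Definition enc_instance (I : instance) : tree :=
  enc_list [:: enc_nat (idim I); enc_nat #|idom I|; enc_set (iinit I);
    enc_rel (ihor I); enc_rel (iver I); enc_rel (imulti I); enc_set (iacc I)].

Definition enc_kripke (AP : finType) (K : kripke AP) : tree :=
  enc_list [:: enc_nat #|kstate K|; enc_rel (ktrans K);
    enc_list [seq enc_set (klabel s) | s <- enum (kstate K)];
    enc_fin (kinit K)].

Fixpoint enc_pform (AP : finType) (f : pform AP) : tree :=
  match f with
  | PTrue => enc_list [:: enc_nat 0]
  | PAtom p => enc_list [:: enc_nat 1; enc_fin p]
  | PNot g => enc_list [:: enc_nat 2; enc_pform g]
  | PAnd g h => enc_list [:: enc_nat 3; enc_pform g; enc_pform h]
  | POr g h => enc_list [:: enc_nat 4; enc_pform g; enc_pform h]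
  end.

Fixpoint enc_regexp (AP : finType) (r : regexp AP) : tree :=
  match r with
  | REps => enc_list [:: enc_nat 0]
  | RProp f => enc_list [:: enc_nat 1; enc_pform f]
  | RUnion r1 r2 => enc_list [:: enc_nat 2; enc_regexp r1; enc_regexp r2]
  | RCat r1 r2 => enc_list [:: enc_nat 3; enc_regexp r1; enc_regexp r2]
  | RStar r1 => enc_list [:: enc_nat 4; enc_regexp r1]
  end.

Fixpoint enc_form (AP : finType) (psi : form AP) : tree :=
  match psi with
  | FReg r => enc_list [:: enc_nat 0; enc_regexp r]
  | FNot psi1 => enc_list [:: enc_nat 1; enc_form psi1]
  | FAnd psi1 psi2 => enc_list [:: enc_nat 2; enc_form psi1; enc_form psi2]
  | FB psi1 => enc_list [:: enc_nat 3; enc_form psi1]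
  | FEbar psi1 => enc_list [:: enc_nat 4; enc_form psi1]
  end.

Definition enc_mc (AP : finType) (x : kripke AP * form AP) : tree :=
  Node (enc_kripke x.1) (enc_form x.2).

(* Main.v *)
Require Import Defs.
From mathcomp Require Import all_boot.
From mathcomp Require Import zify.
From Stdlib Require Import Classical.
(* Imported again because the file [tuple] also defines a [tsize]. *)
Import Defs.

(** The Kripke structure has two states with all transitions, so that traces are
    nonempty words over two letters and [Ebar] pushes an arbitrary word to the
    left. Such words encode lists of cells, a cell being a level, a row and a
    column (the latter two in binary) together with a domino type; a list of
    cells is read as a set of facts "the tiling of level l has type a at (i, j)".

    Each player pushes the cells of one initial row, and finally the cells of all
    the tilings are pushed. A list of cells is checked by pushing one more cell,
    the marker, which ranges over all addresses (i, j): a prefix of the trace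
    ends at some cell, and comparing its bits with those of the marker at the
    left end of the trace takes one regular expression per bit. Boolean
    combinations of such prefix formulas express that the cells at (i, j),
    (i, j + 1) and (i + 1, j) satisfy the matching relations. To make sure that
    the marker is a single cell, the first cell of every push is flagged, and the
    number of flags in the trace is prescribed.

    Polynomial time is obtained from closure properties: programs for pairing,
    projections and folds over lists whose accumulator stays polynomially
    bounded. *)

Set Implicit Arguments.
Unset Strict Implicit.
Unset Printing Implicit Defensive.

(** * Polynomial-time tree functions *)

Lemma tsize_gt0 t : 0 < tsize t.
Proof. by case: t. Qed.

Lemma leq_expn_base m n k : m <= n -> m ^ k <= n ^ k.
Proof. by case: k => // k; rewrite leq_exp2r. Qed.

(** Constants are the case [k = 0]. Sizes of trees are positive, so exponents can be raised freely,
    which gives closure under sums. *)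
Definition bounded (T : Type) (e : T -> tree) (g : T -> nat) : Prop :=
  exists c k, forall a, g a <= c * tsize (e a) ^ k.

Lemma bounded_le T (e : T -> tree) g h :
  (forall a, g a <= h a) -> bounded e h -> bounded e g.
Proof.
by move=> gh [c [k hb]]; exists c, k => a; apply: leq_trans (gh a) (hb a).
Qed.

Lemma bounded_const T (e : T -> tree) c : bounded e (fun=> c).
Proof. by exists c, 0 => a; rewrite muln1. Qed.

Lemma bounded_size T (e : T -> tree) : bounded e (fun a => tsize (e a)).
Proof. by exists 1, 1 => a; rewrite mul1n expn1. Qed.

Lemma bounded_add T (e : T -> tree) g h :
  bounded e g -> bounded e h -> bounded e (fun a => g a + h a).
Proof.
move=> [c [k gb]] [c' [k' hb]]; exists (c + c'), (k + k') => a.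
rewrite mulnDl leq_add //.
  by apply: leq_trans (gb a) _; rewrite leq_mul2l leq_pexp2l ?tsize_gt0 ?orbT // leq_addr.
by apply: leq_trans (hb a) _; rewrite leq_mul2l leq_pexp2l ?tsize_gt0 ?orbT // leq_addl.
Qed.

Lemma bounded_mul T (e : T -> tree) g h :
  bounded e g -> bounded e h -> bounded e (fun a => g a * h a).
Proof.
move=> [c [k gb]] [c' [k' hb]]; exists (c * c'), (k + k') => a.
by rewrite expnD mulnACA leq_mul.
Qed.

Lemma bounded_exp T (e : T -> tree) g k :
  bounded e g -> bounded e (fun a => g a ^ k).
Proof.
move=> gb; elim: k => [|k IH]; first exact: bounded_const.
by apply: (@bounded_le _ _ _ (fun a => g a * g a ^ k)) (bounded_mul gb IH) => a; rewrite expnS.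
Qed.

Lemma bounded_trans T (e f : T -> tree) g :
  bounded e (fun a => tsize (f a)) -> bounded f g -> bounded e g.
Proof.
move=> fb [c [k gb]]; apply: bounded_le gb _.
exact: bounded_mul (bounded_const _ _) (bounded_exp _ fb).
Qed.

(** Every instruction is charged for what it reads and builds. Output sizes are thus bounded by
    running times, which makes polynomial time closed under composition. *)
Lemma run_size p x y t : run p x y t -> tsize x <= t /\ tsize y <= t.
Proof.
elim=> {p x y t} //=.
- by move=> x; rewrite tsize_gt0.
- by case=> [|a b] //=; split=> //; lia.
- by case=> [|a b] //=; split=> //; lia.
all: by intros; lia.
Qed.

(** Input and output are two trees indexed by the same [a : T]. A program is thus constrained only
    on the codes [e a], and the type of the coded output may depend on [a], as that of formulas over
    [AP_of (idom I)] does. *)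
Definition ptime (T : Type) (e f : T -> tree) : Prop :=
  exists p g, bounded e g /\
    forall a, exists2 t, run p (e a) (f a) t & t <= g a.

Lemma ptime_size T (e f : T -> tree) :
  ptime e f -> bounded e (fun a => tsize (f a)).
Proof.
move=> [p [g [gb H]]]; apply: bounded_le gb => a.
by have [t /run_size[_ ft] tg] := H a; apply: leq_trans ft tg.
Qed.

Lemma ptime_ext T (e f g : T -> tree) :
  (forall a, f a = g a) -> ptime e f -> ptime e g.
Proof.
move=> fg [p [b [bb H]]]; exists p, b; split=> // a.
by rewrite -fg.
Qed.

Lemma ptime_id T (e : T -> tree) : ptime e e.
Proof.
exists Id, (fun a => tsize (e a)); split; first exact: bounded_size.
by move=> a; exists (tsize (e a)) => //; apply: RunId.
Qed.

Lemma ptime_trans T (e f g : T -> tree) : ptime e f -> ptime f g -> ptime e g.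
Proof.
move=> ef; have fb := ptime_size ef.
case: ef => p [b [bb H]] [q [b' [bb' H']]].
exists (Comp q p), (fun a => b a + b' a); split.
  by apply: bounded_add bb _; apply: bounded_trans fb bb'.
move=> a; have [t rt tb] := H a; have [t' rt' tb'] := H' a.
by exists (t + t'); [apply: RunComp rt rt' | apply: leq_add].
Qed.

Lemma ptime_reindex T U (h : U -> T) (e f : T -> tree) :
  ptime e f -> ptime (fun u => e (h u)) (fun u => f (h u)).
Proof.
move=> [p [g [[c [k gb]] H]]]; exists p, (fun u => g (h u)); split=> //.
by exists c, k.
Qed.

Lemma ptime_node T (e f g : T -> tree) :
  ptime e f -> ptime e g -> ptime e (fun a => Node (f a) (g a)).
Proof.
move=> ef eg; have fb := ptime_size ef; have gb := ptime_size eg.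
case: ef eg => p [b [bb H]] [q [b' [bb' H']]].
exists (Pair p q), (fun a => (b a + b' a) + (tsize (f a) + tsize (g a) + 1)); split.
  apply: bounded_add (bounded_add bb bb') _.
  by apply: bounded_add (bounded_add fb gb) _; apply: bounded_const.
move=> a; have [t rt tb] := H a; have [t' rt' tb'] := H' a.
by eexists; [apply: RunPair rt rt' | rewrite /= addn1 leq_add2r leq_add].
Qed.

Lemma ptime_leaf T (e : T -> tree) : ptime e (fun=> Leaf).
Proof.
exists Nil, (fun a => tsize (e a)); split; first exact: bounded_size.
by move=> a; exists (tsize (e a)) => //; apply: RunNil.
Qed.

Lemma ptime_const T (e : T -> tree) t : ptime e (fun=> t).
Proof.
elim: t => [|t1 IH1 t2 IH2]; first exact: ptime_leaf.
exact: ptime_node IH1 IH2.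
Qed.

Lemma ptime_head T (e f : T -> tree) : ptime e f -> ptime e (fun a => thead (f a)).
Proof.
move=> ef; apply: ptime_trans ef _.
exists Hd, (fun a => tsize (f a)); split; first exact: bounded_size.
by move=> a; exists (tsize (f a)) => //; apply: RunHd.
Qed.

Lemma ptime_tail T (e f : T -> tree) : ptime e f -> ptime e (fun a => ttail (f a)).
Proof.
move=> ef; apply: ptime_trans ef _.
exists Tl, (fun a => tsize (f a)); split; first exact: bounded_size.
by move=> a; exists (tsize (f a)) => //; apply: RunTl.
Qed.

Lemma tsize_enc_list s : tsize (enc_list s) = (sumn [seq (tsize t).+1 | t <- s]).+1.
Proof. by elim: s => //= t s ->; rewrite addSn addnS. Qed.

Lemma size_enc_list s : size s <= tsize (enc_list s).
Proof. by elim: s => //= t s; lia. Qed.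

Lemma mem_tsize_enc_list (U : Type) (eU : U -> tree) (s : seq U) k u0 :
  k < size s -> tsize (eU (nth u0 s k)) <= tsize (enc_list [seq eU u | u <- s]).
Proof. by elim: s k => //= u s IH [|k] /=; last move/IH; lia. Qed.

(** * Loops and folds over lists in polynomial time *)

Section Loop.

Variables (T U A : Type) (e : T -> tree) (eU : U -> tree) (eA : A -> tree).
Variables (l : T -> seq U) (z : T -> A) (step : T -> A -> U -> A) (B : T -> nat).

(** A loop state holds the fixed input, the list still to be read and the accumulator. [cond]
    extracts the list, whose code is [Leaf] exactly when it is empty. *)
Let st a us acc := Node (e a) (Node (enc_list [seq eU u | u <- us]) (eA acc)).
Let cond := Comp Hd Tl.

(** If [Z] bounds all states met by the loop, one round costs at most [c * Z ^ k] for the body and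
    [Z + Z] for the condition. *)
Lemma run_loop p c k a Z us acc :
    (forall u us acc, exists2 t, run p (st a (u :: us) acc)
       (st a us (step a acc u)) t & t <= c * tsize (st a (u :: us) acc) ^ k) ->
    (forall i, tsize (st a (drop i us) (foldl (step a) acc (take i us))) <= Z) ->
  exists2 t, run (While cond p) (st a us acc) (st a [::] (foldl (step a) acc us)) t
           & t <= (size us).+1 * (c * Z ^ k + (Z + Z)).
Proof.
move=> Hp; have Hc us' acc' : tsize (st a us' acc') <= Z ->
    exists2 t, run cond (st a us' acc') (enc_list [seq eU u | u <- us']) t & t <= Z + Z.
  move=> leZ; eexists; first exact: RunComp (RunTl _) (RunHd _).
  by apply: leq_add => //; apply: leq_trans leZ; rewrite /=; lia.
elim: us acc => [|u us IH] acc HZ.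
  have [|t rt tZ] := Hc [::] acc; first exact: HZ 0.
  by exists t; [apply: RunWhileStop | rewrite mul1n; lia].
have leZ : tsize (st a (u :: us) acc) <= Z by apply: HZ 0.
have [t1 r1 b1] := Hc _ _ leZ; have [t2 r2 b2] := Hp u us acc.
have {}b2 : t2 <= c * Z ^ k.
  by apply: leq_trans b2 _; rewrite leq_mul2l leq_expn_base ?orbT.
have [i|t3 r3 b3] := IH (step a acc u).
  by apply: leq_trans (HZ i.+1); rewrite /=; lia.
exists (t1 + t2 + t3); first exact: RunWhileStep r1 r2 r3.
by rewrite /= mulSn; lia.
Qed.

Hypothesis l_ptime : ptime e (fun a => enc_list [seq eU u | u <- l a]).
Hypothesis z_ptime : ptime e (fun a => eA (z a)).
Hypothesis step_ptime :
  ptime (fun s : T * U * A => Node (e s.1.1) (Node (eU s.1.2) (eA s.2)))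
        (fun s => eA (step s.1.1 s.2 s.1.2)).
Hypothesis B_bounded : bounded e B.
Hypothesis acc_size : forall a i,
  tsize (eA (foldl (step a) (z a) (take i (l a)))) <= B a.

(** A polynomial-time step may double its accumulator, and iterating it would then be exponential;
    hence the a priori bound [B] on all partial results. *)
Lemma ptime_foldl : ptime e (fun a => eA (foldl (step a) (z a) (l a))).
Proof.
(* The loop body applies [step] and also pops the list, so it is specified on the states whose list
   is nonempty. *)
pose in_st (s : T * (U * seq U) * A) := st s.1.1 (s.1.2.1 :: s.1.2.2) s.2.
have : ptime in_st (fun s => st s.1.1 s.1.2.2 (step s.1.1 s.2 s.1.2.1)).
  have t_id := ptime_id in_st; have t_tl := ptime_tail t_id.
  apply: ptime_node (ptime_head t_id) _.
  apply: ptime_node (ptime_tail (ptime_head t_tl)) _.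
  have step_in := ptime_reindex (fun s : T * (U * seq U) * A => (s.1.1, s.1.2.1, s.2)) step_ptime.
  apply: ptime_trans step_in.
  apply: ptime_node (ptime_head t_id) _.
  exact: ptime_node (ptime_head (ptime_head t_tl)) (ptime_tail t_tl).
move=> [p [g [[c [k gb]] Hp]]].
(* The remaining list is a suffix of [l a] and the accumulator is below [B a]; the 2 counts the two
   nodes of a state. *)
pose Z a := tsize (e a) + tsize (enc_list [seq eU u | u <- l a]) + B a + 2.
have Zb : bounded e Z.
  apply: bounded_add (bounded_const _ _); apply: bounded_add B_bounded.
  exact: bounded_add (bounded_size _) (ptime_size l_ptime).
have loop : ptime (fun a => st a (l a) (z a))
    (fun a => st a [::] (foldl (step a) (z a) (l a))).
  exists (While cond p), (fun a => (tsize (st a (l a) (z a))).+1 * (c * Z a ^ k + (Z a + Z a))).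
  have eb : bounded (fun a => st a (l a) (z a)) (fun a => tsize (e a)).
    by apply: bounded_le (bounded_size _) => a; rewrite /st /=; lia.
  have {}Zb := bounded_trans eb Zb; split.
    apply: bounded_mul (bounded_add (bounded_mul (bounded_const _ _) (bounded_exp _ Zb)) (bounded_add Zb Zb)).
    apply: bounded_le (bounded_add (bounded_size _) (bounded_const _ 1)) => a.
    by rewrite addn1.
  move=> a.
  have [|i|t rt tb] := @run_loop p c k a (Z a) (l a) (z a).
  - move=> u us acc; have [t rt tg] := Hp (a, (u, us), acc).
    by exists t => //; apply: leq_trans tg (gb _).
  - have := acc_size a i; rewrite /st /Z /= map_drop.
    have : tsize (enc_list (drop i [seq eU u | u <- l a])) <= tsize (enc_list [seq eU u | u <- l a]).
      by rewrite !tsize_enc_list map_drop -{2}(cat_take_drop i (map _ (map _ _))) sumn_cat; lia.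
    by lia.
  exists t => //; apply: leq_trans tb _; rewrite leq_mul2r; apply/orP; right.
  by have := size_enc_list [seq eU u | u <- l a]; rewrite size_map /st /=; lia.
have in_loop : ptime e (fun a => st a (l a) (z a)).
  exact: ptime_node (ptime_id _) (ptime_node l_ptime z_ptime).
exact: ptime_trans in_loop (ptime_trans loop (ptime_tail (ptime_tail (ptime_id _)))).
Qed.

End Loop.

Lemma ptime_rev T U (e : T -> tree) (eU : U -> tree) (l : T -> seq U) :
  ptime e (fun a => enc_list [seq eU u | u <- l a]) ->
  ptime e (fun a => enc_list [seq eU u | u <- rev (l a)]).
Proof.
move=> lP; pose eL (s : seq U) := enc_list [seq eU u | u <- s].
have revE (s t : seq U) : foldl (fun acc u => u :: acc) t s = catrev s t.
  by elim: s t => //= u s IH t; rewrite IH.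
apply: (@ptime_ext _ _ (fun a => eL (foldl (fun acc u => u :: acc) [::] (l a)))).
  by move=> a; rewrite revE.
apply: (ptime_foldl (eU := eU) (step := fun _ acc u => u :: acc) (z := fun=> [::])
  (B := fun a => tsize (eL (l a)))) => //.
- exact: ptime_leaf.
- have t_id := ptime_id (fun s : T * U * seq U => Node (e s.1.1) (Node (eU s.1.2) (eL s.2))).
  exact: ptime_node (ptime_head (ptime_tail t_id)) (ptime_tail (ptime_tail t_id)).
- exact: ptime_size lP.
- move=> a i; rewrite revE catrevE cats0 /eL !tsize_enc_list !map_rev sumn_rev.
  by rewrite -{2}(cat_take_drop i (l a)) !map_cat sumn_cat; lia.
Qed.

(** Extended context: the body of a fold sees the outer input together with the bound variable. *)
Definition ext T U (e : T -> tree) (eU : U -> tree) (s : T * U) : tree :=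
  Node (e s.1) (eU s.2).

Lemma ptime_fst T U (e f : T -> tree) (eU : U -> tree) :
  ptime e f -> ptime (ext e eU) (fun s => f s.1).
Proof.
move=> ef; apply: (ptime_trans (f := fun s : T * U => e s.1)).
  exact: ptime_head (ptime_id _).
exact: ptime_reindex ef.
Qed.

Lemma ptime_snd T U (e : T -> tree) (eU : U -> tree) :
  ptime (ext e eU) (fun s => eU s.2).
Proof. exact: ptime_tail (ptime_id _). Qed.

(* Accumulators built with such operations keep a polynomial size under iteration. *)
Definition linear_op (mk : tree -> tree -> tree) : Prop :=
  ptime (fun xy : tree * tree => Node xy.1 xy.2) (fun xy => mk xy.1 xy.2) /\
  exists c, forall x y, tsize (mk x y) <= tsize x + tsize y + c.

(** Each step of a linear operation adds the size of some [F a u] and a constant. Both are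
    polynomially bounded, and so is the number of steps, hence also every partial result. The loop
    reads from the left, so the list is reversed first. *)
Lemma ptime_foldr T U (e z : T -> tree) (eU : U -> tree) (l : T -> seq U)
    (F : T -> U -> tree) mk :
    linear_op mk ->
    ptime e (fun a => enc_list [seq eU u | u <- l a]) ->
    ptime (ext e eU) (fun s => F s.1 s.2) -> ptime e z ->
  ptime e (fun a => foldr (fun u acc => mk (F a u) acc) (z a) (l a)).
Proof.
move=> [mkP [C mkC]] lP FP zP.
apply: (@ptime_ext _ _ (fun a => foldl (fun acc u => mk (F a u) acc) (z a) (rev (l a)))).
  by move=> a; rewrite foldl_rev.
have [c [k FB]] := ptime_size FP.
pose Z a := tsize (e a) + tsize (enc_list [seq eU u | u <- rev (l a)]) + 1.
have rP := ptime_rev lP.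
have Zb : bounded e Z.
  apply: bounded_add (bounded_const _ _).
  exact: bounded_add (bounded_size _) (ptime_size rP).
apply: (ptime_foldl (eU := eU) (eA := id) (step := fun a acc u => mk (F a u) acc)
  (B := fun a => tsize (z a) + Z a * (c * Z a ^ k + C))) => //.
- have t_id := ptime_id (fun s : T * U * tree => Node (e s.1.1) (Node (eU s.1.2) s.2)).
  apply: (ptime_trans (f := fun s : T * U * tree => Node (F s.1.1 s.1.2) s.2)).
    apply: ptime_node (ptime_tail (ptime_tail t_id)).
    have FP' := ptime_reindex (fun s : T * U * tree => s.1) FP.
    apply: ptime_trans FP'.
    exact: ptime_node (ptime_head t_id) (ptime_head (ptime_tail t_id)).
  exact: (ptime_reindex (fun s : T * U * tree => (F s.1.1 s.1.2, s.2)) mkP).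
- apply: bounded_add (ptime_size zP) _; apply: (bounded_mul Zb).
  apply: bounded_add (bounded_const _ _).
  exact: bounded_mul (bounded_const _ _) (bounded_exp _ Zb).
move=> a i; have : tsize (e a) + tsize (enc_list [seq eU u | u <- rev (l a)]) + 1 = Z a by [].
move: (rev (l a)) (Z a) => s y sy; clear Z Zb; rename y into Z.
have len_s : size (take i s) <= Z.
  have := size_enc_list [seq eU u | u <- s].
  by rewrite size_map size_take_min; lia.
apply: leq_trans (_ : tsize (z a) + size (take i s) * (c * Z ^ k + C) <= _); last first.
  by rewrite leq_add2l leq_mul2r len_s orbT.
(* [U] is a bare type without decidable equality, so membership in the list is expressed with
   [nth]. *)
have Fs u : (exists2 j, j < size (take i s) & u = nth u (take i s) j) ->
    tsize (F a u) <= c * Z ^ k.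
  move=> [j jlt uE]; apply: leq_trans (FB (a, u)) _.
  rewrite leq_mul2l leq_expn_base ?orbT //=.
  have jlt' : j < size s by move: jlt; rewrite size_take_min; lia.
  have := mem_tsize_enc_list eU u jlt'.
  have ji : j < i by move: jlt; rewrite size_take_min; lia.
  by rewrite nth_take // in uE; rewrite -uE; lia.
elim: {i len_s}(take i s) (z a) Fs => [|u us IH] y Fs /=; first by rewrite addn0.
apply: leq_trans (IH _ _) _.
  by move=> v [j jlt vE]; apply: Fs; exists j.+1.
rewrite mulSn; have := mkC (F a u) y.
have : tsize (F a u) <= c * Z ^ k by apply: Fs; exists 0.
by lia.
Qed.

(** * Unary arithmetic and intervals of numbers *)

Lemma enc_natE k : enc_nat k = enc_list [seq Leaf | _ <- nseq k tt].
Proof. by elim: k => //= k <-. Qed.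

(** A unary numeral is a list of leaves, so iterating is folding over a numeral. *)
Lemma ptime_iter T (e z F : T -> tree) (k : T -> nat) mk :
    linear_op mk -> ptime e (fun a => enc_nat (k a)) ->
    ptime e F -> ptime e z ->
  ptime e (fun a => iter (k a) (mk (F a)) (z a)).
Proof.
move=> mkP kP FP zP.
apply: (@ptime_ext _ _ (fun a => foldr (fun u acc => mk (F a) acc) (z a) (nseq (k a) tt))).
  by move=> a; elim: (k a) => //= n ->.
apply: (@ptime_foldr _ _ _ _ (fun=> Leaf) _ (fun a _ => F a)) => //.
  by apply: ptime_ext kP => a; rewrite enc_natE.
exact: ptime_fst FP.
Qed.

Lemma linear_node : linear_op Node.
Proof. by split; [apply: ptime_id | exists 1 => x y /=; lia]. Qed.

Lemma ptime_addn T (e : T -> tree) (m n : T -> nat) :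
    ptime e (fun a => enc_nat (m a)) -> ptime e (fun a => enc_nat (n a)) ->
  ptime e (fun a => enc_nat (m a + n a)).
Proof.
move=> mP nP; have := ptime_iter linear_node mP (ptime_leaf e) nP.
by apply: ptime_ext => a; rewrite /enc_nat iterD.
Qed.

Lemma ptime_succ T (e : T -> tree) (m : T -> nat) :
  ptime e (fun a => enc_nat (m a)) -> ptime e (fun a => enc_nat (m a).+1).
Proof. exact: ptime_node (ptime_leaf e). Qed.

Lemma ptime_subn T (e : T -> tree) (m n : T -> nat) :
    ptime e (fun a => enc_nat (m a)) -> ptime e (fun a => enc_nat (n a)) ->
  ptime e (fun a => enc_nat (m a - n a)).
Proof.
move=> mP nP.
(* Subtraction iterates [ttail], which fixes [Leaf] and therefore truncates at 0. *)
have lin : linear_op (fun _ y => ttail y).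
  split; first exact: ptime_tail (ptime_tail (ptime_id _)).
  by exists 0 => x [|y y'] /=; lia.
have := ptime_iter lin nP (ptime_leaf e) mP.
apply: ptime_ext => a; elim: (n a) => [|k IH]; first by rewrite subn0.
by rewrite iterS IH subnS; case: (m a - k).
Qed.

Lemma tsize_enc_nat k : tsize (enc_nat k) = k.*2.+1.
Proof. by elim: k => //= k ->; lia. Qed.

(** The loop carries the next number and the numbers already produced, in reverse order. *)
Lemma ptime_iota T (e : T -> tree) (m n : T -> nat) :
    ptime e (fun a => enc_nat (m a)) -> ptime e (fun a => enc_nat (n a)) ->
  ptime e (fun a => enc_list [seq enc_nat i | i <- iota (m a) (n a)]).
Proof.
move=> mP nP.
pose eA (s : nat * seq nat) := Node (enc_nat s.1) (enc_list [seq enc_nat i | i <- s.2]).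
pose step (s : nat * seq nat) := (s.1.+1, s.1 :: s.2).
have stepE j k : iter k step (j, [::]) = (j + k, rev (iota j k)).
  elim: k => [|k IH]; first by rewrite addn0.
  by rewrite iterS IH /step addnS -(addn1 k) iotaD rev_cat.
have foldE a k : foldl (fun acc _ => step acc) (m a, [::]) (nseq k tt) =
    (m a + k, rev (iota (m a) k)).
  by rewrite -stepE; elim: k (m a, [::]) => //= k IH s; rewrite IH -iterSr iterS.
apply: (@ptime_ext _ _ (fun a => enc_list [seq enc_nat i | i <- rev (rev (iota (m a) (n a)))])).
  by move=> a; rewrite revK.
(* The numeral of [j] has size [j.*2.+1], so [M a] bounds the contribution of each list entry and
   also the number of entries. *)
apply: ptime_rev; pose M a := (m a + n a).*2.+2.
have Mb : bounded e M.
  apply: bounded_le (bounded_add (ptime_size mP) (bounded_add (ptime_size nP) (bounded_const _ 2))) => a.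
  by rewrite !tsize_enc_nat /M; lia.
have : ptime e (fun a => eA (foldl (fun acc _ => step acc) (m a, [::]) (nseq (n a) tt))).
  apply: (ptime_foldl (eU := fun=> Leaf) (B := fun a => M a + (M a * M a + 2)) (step := fun _ acc _ => step acc)).
  - by apply: ptime_ext nP => a; rewrite enc_natE.
  - exact: ptime_node mP (ptime_leaf _).
  - have t_id := ptime_id (fun s : T * unit * (nat * seq nat) => Node (e s.1.1) (Node Leaf (eA s.2))).
    have t_acc := ptime_tail (ptime_tail t_id).
    apply: ptime_node (ptime_succ (ptime_head t_acc)) _.
    exact: ptime_node (ptime_head t_acc) (ptime_tail t_acc).
  - exact: bounded_add Mb (bounded_add (bounded_mul Mb Mb) (bounded_const _ 2)).
  move=> a i.
  have -> : take i (nseq (n a) tt) = nseq (minn i (n a)) tt.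
    by elim: i (n a) => [|i IH] [|k] //=; rewrite IH minnSS.
  rewrite foldE /eA /= tsize_enc_nat tsize_enc_list.
  rewrite !map_rev sumn_rev -map_comp.
  have le_M : sumn [seq (tsize (enc_nat j)).+1 | j <- iota (m a) (minn i (n a))] <= minn i (n a) * M a.
    have : (m a + minn i (n a)).*2 <= M a by rewrite /M; lia.
    elim: (minn i (n a)) (m a) => [|k IH] j //= jk.
    by rewrite tsize_enc_nat mulSn leq_add ?IH //; lia.
  have : minn i (n a) * M a <= M a * M a by rewrite leq_mul2r /M; apply/orP; right; lia.
  rewrite (eq_map (g := fun j => (tsize (enc_nat j)).+1)) //.
  have : (m a + minn i (n a)).*2.+2 <= M a by rewrite /M; lia.
  by lia.
move/ptime_tail; apply: ptime_ext => a.
by rewrite foldE.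
Qed.

(** * The reduction *)

Lemma AP_of_gt0 (D : finType) : 0 < #|AP_of D|.
Proof. by apply/card_gt0P; exists (inr true). Qed.

(* The only atom used: the one of rank 0, whose code does not depend on [D]. *)
Definition atom0 (D : finType) : AP_of D := enum_val (Ordinal (AP_of_gt0 D)).

Lemma enc_atom0 D : enc_fin (atom0 D) = Leaf.
Proof. by rewrite /enc_fin enum_valK. Qed.

Section Formulas.

Variable I : instance.
Local Notation n := (idim I).
Local Notation d := #|idom I|.
Local Notation AP := (AP_of (idom I)).

Definition ranks (A : {set idom I}) : seq nat :=
  [seq (enum_rank x : nat) | x <- enum A].
Definition pair_ranks (A : {set idom I * idom I}) : seq (nat * nat) :=
  [seq (enum_rank x.1 : nat, enum_rank x.2 : nat) | x <- enum A].

Definition rany : regexp AP := RProp PTrue.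
Definition rlit (b : bool) : regexp AP :=
  RProp (if b then PAtom (atom0 _) else PNot (PAtom (atom0 _))).
Definition rpow (r : regexp AP) k : regexp AP := iter k (RCat r) REps.

Definition FTrue : form AP := FReg (RStar rany).
Definition FOr (f g : form AP) : form AP := FNot (FAnd (FNot f) (FNot g)).
Definition bigand U (s : seq U) (F : U -> form AP) : form AP :=
  foldr (fun u acc => FAnd (F u) acc) FTrue s.
Definition bigor U (s : seq U) (F : U -> form AP) : form AP :=
  foldr (fun u acc => FOr (F u) acc) (FNot FTrue) s.

(* On a word [x ++ m ++ rev c], these read the bits [q] of [x] and of [c]; cells
   are written in reverse so that both bits are at distance [q] from an end. *)
Definition xbit b q : form AP := FReg (RCat (rpow rany q) (RCat (rlit b) (RStar rany))).
Definition ybit b q : form AP := FReg (RCat (RStar rany) (RCat (rlit b) (rpow rany q))).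

Definition bits_are b b' q : form AP := FAnd (xbit b q) (ybit b' q).
Definition eq_bit q : form AP := FOr (bits_are true true q) (bits_are false false q).
Definition eq_field o m : form AP := bigand (iota o m) eq_bit.
(* Binary successor: [p] is the bit that absorbs the carry. *)
Definition succ_field o m : form AP :=
  bigor (iota 0 m) (fun p => FAnd (bits_are false true (o + p))
    (FAnd (bigand (iota o p) (bits_are true false))
          (bigand (iota (o + p).+1 (m - p.+1)) eq_bit))).
Definition onesx o m : form AP := bigand (iota o m) (xbit true).
Definition onesy o m : form AP := bigand (iota o m) (ybit true).

(* Layout of a cell: flag, one-hot domino type, column, one-hot level, row. *)
Definition colo := d.+1.
Definition levo := (d + n).+1.
Definition rowo := (d + n + n).+1.
Definition width := (d + n + n + n).+1.

(* The prefix chosen by [FB] must consist of the marker and at least one cell. *)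
Definition at_cell (A : form AP) (l a : nat) : form AP :=
  FB (FAnd (FReg (RCat (rpow rany width) (RCat (rpow rany width) (RStar (rpow rany width)))))
    (FAnd (ybit true (levo + l)) (FAnd (ybit true a.+1) A))).

Definition Ahere : form AP := FAnd (eq_field rowo n) (eq_field colo n).
Definition Aright : form AP := FAnd (eq_field rowo n) (succ_field colo n).
Definition Abelow : form AP := FAnd (succ_field rowo n) (eq_field colo n).
(** Comparing columns is enough for the initial words, because the cells of these pushes are forced
    into row 0. *)
Definition Acol : form AP := eq_field colo n.
Definition Alast : form AP := onesy rowo n.

Definition some_at A l (s : seq nat) : form AP := bigor s (at_cell A l).
Definition pair_at A l A' l' (s : seq (nat * nat)) : form AP :=
  bigor s (fun ab => FAnd (at_cell A l ab.1) (at_cell A' l' ab.2)).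
Definition functional l : form AP :=
  bigand (iota 0 d) (fun a => bigand (iota 0 a) (fun b =>
    FNot (FAnd (at_cell Ahere l a) (at_cell Ahere l b)))).

(** Functionality is imposed at all levels: a push may contain cells of levels fixed in earlier
    rounds, and these must not contradict the words already chosen. *)
Definition good_init l : form AP :=
  FAnd (some_at Acol l (ranks (iinit I))) (bigand (iota 0 n) functional).
Definition good_level l : form AP :=
  FAnd (functional l) (FAnd (some_at Ahere l (iota 0 d))
    (FAnd (FOr (onesx colo n) (pair_at Ahere l Aright l (pair_ranks (ihor I))))
          (FOr (onesx rowo n) (pair_at Ahere l Abelow l (pair_ranks (iver I)))))).
Definition good_final : form AP :=
  FAnd (bigand (iota 0 n) good_level)
    (FAnd (bigand (iota 0 n.-1) (fun l => pair_at Ahere l Ahere l.+1 (pair_ranks (imulti I))))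
          (some_at Alast n.-1 (ranks (iacc I)))).

Definition rcell z y b : regexp AP := RCat (rpow (rlit false) z) (RCat (rpow rany y) (rlit b)).
(* [k] blocks, each being a flagged cell followed by unflagged ones; the last
   letter is the initial state. *)
Definition rshape k z y : regexp AP :=
  iter k (fun r => RCat (rcell z y true) (RCat (RStar (rcell z y false)) r)) rany.

(* The second conjunct quantifies over pushes of exactly [width] letters: after a
   longer push, the cell next to the marker would carry a flag beyond the [k]
   flags already present. *)
Definition valid k z y (G : form AP) : form AP :=
  FAnd (FReg (rshape k z y))
    (FNot (FEbar (FAnd (FReg (RCat (rpow rany width) (rshape k z y))) (FNot G)))).

(* [~ <Ebar>(V /\ ~ <Ebar>(V' /\ ...))] alternates the quantifiers as
   [Ebar](V -> <Ebar>(V' /\ ...)) does. The [z] zeros forbid rows other than 0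
   and the levels of the rounds still to be played. *)
Definition game : form AP :=
  foldr (fun l acc => FNot (FEbar (FAnd (valid l.+1 (n - l.+1 + n) (l.+1 + n + d) (good_init l)) acc)))
    (FEbar (valid n.+1 0 (d + n + n + n) good_final)) (iota 0 n).

(** [FReg rany] singles out the one-letter initial trace, from which the game starts; longer initial
    traces satisfy the formula vacuously. *)
Definition mc_form : form AP := FNot (FAnd (FReg rany) (FNot game)).

Definition mc_kripke : kripke AP :=
  @Kripke AP bool [set: bool * bool] (fun b => if b then [set atom0 _] else set0) false.

End Formulas.

(** * Complexity of the reduction *)

Section Encodings.

Variables (T : Type) (e : T -> tree) (J : T -> instance).
Local Notation AP a := (AP_of (idom (J a))).
Local Notation ptn m := (ptime e (fun a => enc_nat (m a))).
Local Notation ptr r := (ptime e (fun a => enc_regexp (r a))).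
Local Notation ptf f := (ptime e (fun a => enc_form (f a))).

Let ptl1 f t : ptime e f -> ptime e (fun a => enc_list [:: t; f a]).
Proof. by move=> fP; apply: ptime_node (ptime_const _ _) (ptime_node fP (ptime_leaf _)). Qed.

Let ptl2 f g t : ptime e f -> ptime e g -> ptime e (fun a => enc_list [:: t; f a; g a]).
Proof.
move=> fP gP; apply: ptime_node (ptime_const _ _) _.
exact: ptime_node fP (ptime_node gP (ptime_leaf _)).
Qed.

Lemma ptime_rany : ptr (fun a => rany (J a)).
Proof. exact: (ptime_const e (enc_list [:: enc_nat 1; enc_list [:: enc_nat 0]])). Qed.

Lemma ptime_rlit b : ptr (fun a => rlit (J a) b).
Proof.
pose atom := enc_list [:: enc_nat 1; Leaf].
pose lit := enc_list [:: enc_nat 1; if b then atom else enc_list [:: enc_nat 2; atom]].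
by apply: ptime_ext (ptime_const e lit) => a; case: b @lit; rewrite /= enc_atom0.
Qed.

Lemma ptime_FReg (r : forall a, regexp (AP a)) : ptr r -> ptf (fun a => FReg (r a)).
Proof. exact: ptl1. Qed.
Lemma ptime_RStar (r : forall a, regexp (AP a)) : ptr r -> ptr (fun a => RStar (r a)).
Proof. exact: ptl1. Qed.
Lemma ptime_RCat (r s : forall a, regexp (AP a)) :
  ptr r -> ptr s -> ptr (fun a => RCat (r a) (s a)).
Proof. exact: ptl2. Qed.
Lemma ptime_FNot (f : forall a, form (AP a)) : ptf f -> ptf (fun a => FNot (f a)).
Proof. exact: ptl1. Qed.
Lemma ptime_FB (f : forall a, form (AP a)) : ptf f -> ptf (fun a => FB (f a)).
Proof. exact: ptl1. Qed.
Lemma ptime_FEbar (f : forall a, form (AP a)) : ptf f -> ptf (fun a => FEbar (f a)).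
Proof. exact: ptl1. Qed.
Lemma ptime_FAnd (f g : forall a, form (AP a)) :
  ptf f -> ptf g -> ptf (fun a => FAnd (f a) (g a)).
Proof. exact: ptl2. Qed.
Lemma ptime_FOr (f g : forall a, form (AP a)) :
  ptf f -> ptf g -> ptf (fun a => FOr (f a) (g a)).
Proof. by move=> fP gP; apply/ptime_FNot/ptime_FAnd; apply: ptime_FNot. Qed.

Lemma linear_enc2 t : linear_op (fun x y => enc_list [:: t; x; y]).
Proof.
split; last by exists (tsize t + 4) => x y /=; lia.
have t_id := ptime_id (fun s : tree * tree => Node s.1 s.2).
apply: ptime_node (ptime_const _ _) _; apply: ptime_node (ptime_head t_id) _.
exact: ptime_node (ptime_tail t_id) (ptime_leaf _).
Qed.

Lemma linear_comp1 t mk : linear_op mk -> linear_op (fun x y => enc_list [:: t; mk x y]).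
Proof.
move=> [mkP [c mkC]]; split; last first.
  by exists (tsize t + c + 3) => x y /=; have := mkC x y; lia.
exact: ptime_node (ptime_const _ _) (ptime_node mkP (ptime_leaf _)).
Qed.

Lemma ptime_rpow (r : forall a, regexp (AP a)) k :
  ptr r -> ptn k -> ptr (fun a => rpow (r a) (k a)).
Proof.
move=> rP kP; have := ptime_iter (linear_enc2 (enc_nat 3)) kP rP (ptime_const e (enc_list [:: enc_nat 0])).
by apply: ptime_ext => a; rewrite /rpow; elim: (k a) => //= m ->.
Qed.

Lemma ptime_bigand U (eU : U -> tree) (s : T -> seq U) (F : forall a, U -> form (AP a)) :
    ptime e (fun a => enc_list [seq eU u | u <- s a]) ->
    ptime (ext e eU) (fun c => enc_form (F c.1 c.2)) ->
  ptf (fun a => bigand (s a) (F a)).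
Proof.
move=> sP FP.
have := ptime_foldr (F := fun a u => enc_form (F a u)) (linear_enc2 (enc_nat 2)) sP FP (ptl1 (enc_nat 0) (ptl1 (enc_nat 4) ptime_rany)).
by apply: ptime_ext => a; elim: (s a) => //= u us ->.
Qed.

Lemma ptime_bigor U (eU : U -> tree) (s : T -> seq U) (F : forall a, U -> form (AP a)) :
    ptime e (fun a => enc_list [seq eU u | u <- s a]) ->
    ptime (ext e eU) (fun c => enc_form (F c.1 c.2)) ->
  ptf (fun a => bigor (s a) (F a)).
Proof.
move=> sP FP; pose ff t := enc_list [:: enc_nat 1; t].
have linear_or : linear_op (fun x y => ff (enc_list [:: enc_nat 2; ff x; ff y])).
  (* 30 exceeds the total size of the fixed tags and list cells. *)
  split; last by exists 30 => x y /=; lia.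
  have t_id := ptime_id (fun s : tree * tree => Node s.1 s.2).
  do ![apply: ptime_node; try exact: ptime_const].
    exact: ptime_head t_id.
  exact: ptime_tail t_id.
have := ptime_foldr (F := fun a u => enc_form (F a u)) linear_or sP FP
  (ptl1 (enc_nat 1) (ptl1 (enc_nat 0) (ptl1 (enc_nat 4) ptime_rany))).
by apply: ptime_ext => a; elim: (s a) => //= u us ->.
Qed.

End Encodings.

Lemma ptime_iota0 T (e : T -> tree) (m : T -> nat) :
    ptime e (fun a => enc_nat (m a)) ->
  ptime e (fun a => enc_list [seq enc_nat i | i <- iota 0 (m a)]).
Proof. exact: (ptime_iota (m := fun=> 0) (ptime_leaf e)). Qed.

(** * Reading the components of an instance *)

Section InstanceFields.

Variables (T : Type) (e : T -> tree) (J : T -> instance).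
Hypothesis JP : ptime e (fun a => enc_instance (J a)).
Local Notation ptn m := (ptime e (fun a => enc_nat (m a))).
Local Notation ptl eU s := (ptime e (fun a => enc_list [seq eU u | u <- s a])).

Definition enc_pair (ab : nat * nat) : tree := Node (enc_nat ab.1) (enc_nat ab.2).

Let enc_ranks (D : finType) (A : {set D}) :
  enc_set A = enc_list [seq enc_nat u | u <- [seq (enum_rank x : nat) | x <- enum A]].
Proof. by rewrite -map_comp. Qed.

Let enc_pair_ranks (K : instance) (A : {set idom K * idom K}) :
  enc_rel A = enc_list [seq enc_pair u | u <- pair_ranks A].
Proof. by rewrite -map_comp. Qed.

Lemma ptime_idim : ptn (fun a => idim (J a)).
Proof. exact: (ptime_head JP). Qed.
Lemma ptime_card_idom : ptn (fun a => #|idom (J a)|).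
Proof. exact: (ptime_head (ptime_tail JP)). Qed.
Lemma ptime_iinit : ptl enc_nat (fun a => ranks (iinit (J a))).
Proof.
apply: ptime_ext (ptime_head (ptime_tail (ptime_tail JP))) => a.
exact: enc_ranks.
Qed.
Lemma ptime_ihor : ptl enc_pair (fun a => pair_ranks (ihor (J a))).
Proof.
apply: ptime_ext (ptime_head (ptime_tail (ptime_tail (ptime_tail JP)))) => a.
exact: enc_pair_ranks.
Qed.
Lemma ptime_iver : ptl enc_pair (fun a => pair_ranks (iver (J a))).
Proof.
apply: ptime_ext (ptime_head (ptime_tail (ptime_tail (ptime_tail (ptime_tail JP))))) => a.
exact: enc_pair_ranks.
Qed.
Lemma ptime_imulti : ptl enc_pair (fun a => pair_ranks (imulti (J a))).
Proof.
apply: ptime_ext (ptime_head (ptime_tail (ptime_tail (ptime_tail (ptime_tail (ptime_tail JP)))))) => a.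
exact: enc_pair_ranks.
Qed.
Lemma ptime_iacc : ptl enc_nat (fun a => ranks (iacc (J a))).
Proof.
apply: ptime_ext (ptime_head (ptime_tail (ptime_tail (ptime_tail (ptime_tail (ptime_tail (ptime_tail JP))))))) => a.
exact: enc_ranks.
Qed.

Lemma ptime_colo : ptn (fun a => colo (J a)).
Proof. exact: ptime_succ ptime_card_idom. Qed.
Lemma ptime_levo : ptn (fun a => levo (J a)).
Proof. exact: ptime_succ (ptime_addn ptime_card_idom ptime_idim). Qed.
Lemma ptime_rowo : ptn (fun a => rowo (J a)).
Proof. apply/ptime_succ/ptime_addn; [exact: (ptime_addn ptime_card_idom ptime_idim) | exact: ptime_idim]. Qed.
Lemma ptime_width : ptn (fun a => width (J a)).
Proof.
apply/ptime_succ/ptime_addn/ptime_idim/ptime_addn/ptime_idim.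
exact: (ptime_addn ptime_card_idom ptime_idim).
Qed.

End InstanceFields.

(** * Computing the tests on bits and cells *)

Section BitTests.

Variables (T : Type) (e : T -> tree) (J : T -> instance).
Local Notation ptn m := (ptime e (fun a => enc_nat (m a))).
Local Notation ptf f := (ptime e (fun a => enc_form (f a))).

Lemma ptime_xbit b q : ptn q -> ptf (fun a => xbit (J a) b (q a)).
Proof.
move=> qP; apply/ptime_FReg/ptime_RCat/ptime_RCat/ptime_RStar/ptime_rany.
  exact: ptime_rpow (ptime_rany _ _) qP.
exact: ptime_rlit.
Qed.
Lemma ptime_ybit b q : ptn q -> ptf (fun a => ybit (J a) b (q a)).
Proof.
move=> qP; apply/ptime_FReg/ptime_RCat/ptime_RCat.
- exact/ptime_RStar/ptime_rany.
- exact: ptime_rlit.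
- exact: ptime_rpow (ptime_rany _ _) qP.
Qed.
Lemma ptime_bits_are b b' q : ptn q -> ptf (fun a => bits_are (J a) b b' (q a)).
Proof. by move=> qP; apply: ptime_FAnd; [apply: ptime_xbit | apply: ptime_ybit]. Qed.
Lemma ptime_eq_bit q : ptn q -> ptf (fun a => eq_bit (J a) (q a)).
Proof. by move=> qP; apply: ptime_FOr; apply: ptime_bits_are. Qed.

End BitTests.

Section CellTests.

Variables (T : Type) (e : T -> tree) (J : T -> instance).
Hypothesis JP : ptime e (fun a => enc_instance (J a)).
Local Notation ptn m := (ptime e (fun a => enc_nat (m a))).
Local Notation ptr r := (ptime e (fun a => enc_regexp (r a))).
Local Notation ptf f := (ptime e (fun a => enc_form (f a))).

Section Fields.
Variables o m : T -> nat.
Hypotheses (oP : ptn o) (mP : ptn m).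

Lemma ptime_eq_field : ptf (fun a => eq_field (J a) (o a) (m a)).
Proof.
apply: (ptime_bigand (eU := enc_nat)); first exact: ptime_iota oP mP.
apply: (@ptime_eq_bit _ _ (fun s => J s.1)); exact: ptime_snd.
Qed.
Lemma ptime_onesx : ptf (fun a => onesx (J a) (o a) (m a)).
Proof.
apply: (ptime_bigand (eU := enc_nat)); first exact: ptime_iota oP mP.
apply: (@ptime_xbit _ _ (fun s => J s.1)); exact: ptime_snd.
Qed.
Lemma ptime_onesy : ptf (fun a => onesy (J a) (o a) (m a)).
Proof.
apply: (ptime_bigand (eU := enc_nat)); first exact: ptime_iota oP mP.
apply: (@ptime_ybit _ _ (fun s => J s.1)); exact: ptime_snd.
Qed.
End Fields.

Lemma ptime_succ_field o m : ptn o -> ptn m -> ptf (fun a => succ_field (J a) (o a) (m a)).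
Proof.
move=> oP mP.
apply: (ptime_bigor (eU := enc_nat)); first exact: ptime_iota0 mP.
have oP' := ptime_fst enc_nat oP; have mP' := ptime_fst enc_nat mP.
have pP := ptime_snd e enc_nat; have opP := ptime_addn oP' pP.
apply: ptime_FAnd; first exact: (@ptime_bits_are _ _ (fun s => J s.1)).
apply: ptime_FAnd.
  apply: (ptime_bigand (eU := enc_nat)); first exact: ptime_iota oP' pP.
  apply: (@ptime_bits_are _ _ (fun s => J s.1.1)); exact: ptime_snd.
apply: (ptime_bigand (eU := enc_nat)).
  exact: ptime_iota (ptime_succ opP) (ptime_subn mP' (ptime_succ pP)).
apply: (@ptime_eq_bit _ _ (fun s => J s.1.1)); exact: ptime_snd.
Qed.

Let nP := ptime_idim JP.
Let colP := ptime_colo JP.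
Let rowP := ptime_rowo JP.

Lemma ptime_at_cell (A : forall a, form (AP_of (idom (J a)))) l r :
  ptf A -> ptn l -> ptn r -> ptf (fun a => at_cell (A a) (l a) (r a)).
Proof.
move=> AP lP rP; have wP := ptime_rpow (ptime_rany _ J) (ptime_width JP).
apply/ptime_FB/ptime_FAnd.
  by apply/ptime_FReg/ptime_RCat/ptime_RCat/ptime_RStar.
apply: ptime_FAnd; first exact/ptime_ybit/(ptime_addn (ptime_levo JP) lP).
exact/ptime_FAnd/AP/ptime_ybit/ptime_succ.
Qed.

Lemma ptime_Ahere : ptf (fun a => Ahere (J a)).
Proof. by apply: ptime_FAnd; apply: ptime_eq_field. Qed.
Lemma ptime_Aright : ptf (fun a => Aright (J a)).
Proof. by apply: ptime_FAnd; [apply: ptime_eq_field | apply: ptime_succ_field]. Qed.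
Lemma ptime_Abelow : ptf (fun a => Abelow (J a)).
Proof. by apply: ptime_FAnd; [apply: ptime_succ_field | apply: ptime_eq_field]. Qed.
Lemma ptime_Acol : ptf (fun a => Acol (J a)).
Proof. exact: ptime_eq_field. Qed.
Lemma ptime_Alast : ptf (fun a => Alast (J a)).
Proof. exact: ptime_onesy. Qed.

End CellTests.

(** * Computing the validity conditions and the game formula *)

Section Validity.

Variables (T : Type) (e : T -> tree) (J : T -> instance).
Hypothesis JP : ptime e (fun a => enc_instance (J a)).
Local Notation ptn m := (ptime e (fun a => enc_nat (m a))).
Local Notation ptr r := (ptime e (fun a => enc_regexp (r a))).
Local Notation ptf f := (ptime e (fun a => enc_form (f a))).

Let ext_inst U (eU : U -> tree) : ptime (ext e eU) (fun s => enc_instance (J s.1)).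
Proof. exact: ptime_fst JP. Qed.

Lemma ptime_some_at (A : forall a, form (AP_of (idom (J a)))) l s :
    ptf A -> ptn l -> ptime e (fun a => enc_list [seq enc_nat u | u <- s a]) ->
  ptf (fun a => some_at (A a) (l a) (s a)).
Proof.
move=> AP lP sP; apply: (ptime_bigor (eU := enc_nat) sP).
apply: (ptime_at_cell (ext_inst _) (A := fun s => A s.1)) (ptime_snd _ _).
- exact: ptime_fst AP.
- exact: ptime_fst lP.
Qed.

Lemma ptime_pair_at (A A' : forall a, form (AP_of (idom (J a)))) l l' s :
    ptf A -> ptn l -> ptf A' -> ptn l' ->
    ptime e (fun a => enc_list [seq enc_pair u | u <- s a]) ->
  ptf (fun a => pair_at (A a) (l a) (A' a) (l' a) (s a)).
Proof.
move=> AP lP AP' lP' sP; apply: (ptime_bigor (eU := enc_pair) sP).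
have sndP := ptime_snd e enc_pair.
apply: ptime_FAnd.
  apply: (ptime_at_cell (ext_inst _) (A := fun s => A s.1)) (ptime_head sndP).
  - exact: ptime_fst AP.
  - exact: ptime_fst lP.
apply: (ptime_at_cell (ext_inst _) (A := fun s => A' s.1)) (ptime_tail sndP).
- exact: ptime_fst AP'.
- exact: ptime_fst lP'.
Qed.

Lemma ptime_functional l : ptn l -> ptf (fun a => functional (J a) (l a)).
Proof.
move=> lP; apply: (ptime_bigand (eU := enc_nat)).
  exact: ptime_iota0 (ptime_card_idom JP).
apply: (ptime_bigand (J := fun s => J s.1) (eU := enc_nat)
  (F := fun s b => FNot (FAnd (at_cell (Ahere (J s.1)) (l s.1) s.2) (at_cell (Ahere (J s.1)) (l s.1) b)))).
  exact: ptime_iota0 (ptime_snd _ _).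
have JP' := ptime_fst enc_nat (ptime_fst enc_nat JP).
have lP' := ptime_fst enc_nat (ptime_fst enc_nat lP).
apply/ptime_FNot/ptime_FAnd.
  apply: (ptime_at_cell JP') lP' _.
    exact: ptime_Ahere JP'.
  exact: ptime_fst (ptime_snd _ _).
apply: (ptime_at_cell JP') lP' (ptime_snd _ _).
exact: ptime_Ahere JP'.
Qed.

Lemma ptime_rcell z y b : ptn z -> ptn y -> ptr (fun a => rcell (J a) (z a) (y a) b).
Proof.
move=> zP yP; apply: ptime_RCat (ptime_RCat _ (ptime_rlit _ _ _)).
  exact: ptime_rpow (ptime_rlit _ _ _) zP.
exact: ptime_rpow (ptime_rany _ _) yP.
Qed.

Lemma ptime_rshape k z y : ptn k -> ptn z -> ptn y ->
  ptr (fun a => rshape (J a) (k a) (z a) (y a)).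
Proof.
(* A block prepends two regular expressions, whereas [ptime_iter] passes a single tree: they are
   packed into a node that [mk] takes apart. *)
move=> kP zP yP; pose cat x y := enc_list [:: enc_nat 3; x; y].
pose mk x y := cat (thead x) (cat (ttail x) y).
have lin : linear_op mk.
  split; last by exists 30 => - [|x x'] r /=; lia.
  have t_id := ptime_id (fun s : tree * tree => Node s.1 s.2).
  do ![apply: ptime_node; try exact: ptime_const].
  - exact: ptime_head (ptime_head t_id).
  - exact: ptime_tail (ptime_head t_id).
  - exact: ptime_tail t_id.
have cP b := ptime_rcell b zP yP.
have := ptime_iter lin kP (ptime_node (cP true) (ptime_RStar (cP false))) (ptime_rany e J).
by apply: ptime_ext => a; rewrite /rshape; elim: (k a) => //= i <-.
Qed.

Lemma ptime_valid k z y (G : forall a, form (AP_of (idom (J a)))) :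
    ptn k -> ptn z -> ptn y -> ptf G ->
  ptf (fun a => valid (k a) (z a) (y a) (G a)).
Proof.
move=> kP zP yP GP; have sP := ptime_rshape kP zP yP.
apply: ptime_FAnd; first exact: ptime_FReg.
apply/ptime_FNot/ptime_FEbar/ptime_FAnd/ptime_FNot/GP.
apply/ptime_FReg/ptime_RCat/sP.
exact: ptime_rpow (ptime_rany _ _) (ptime_width JP).
Qed.

End Validity.

Section Game.

Variables (T : Type) (e : T -> tree) (J : T -> instance).
Hypothesis JP : ptime e (fun a => enc_instance (J a)).
Local Notation ptn m := (ptime e (fun a => enc_nat (m a))).
Local Notation ptf f := (ptime e (fun a => enc_form (f a))).

Let JP' := ptime_fst enc_nat JP.
Let iota_idim := ptime_iota0 (ptime_idim JP).

Lemma ptime_good_init l : ptn l -> ptf (fun a => good_init (J a) (l a)).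
Proof.
move=> lP; apply: ptime_FAnd.
  exact: (ptime_some_at JP (ptime_Acol JP) lP (ptime_iinit JP)).
apply: (ptime_bigand (eU := enc_nat)) => //.
exact: (ptime_functional JP' (ptime_snd _ _)).
Qed.

Lemma ptime_good_level l : ptn l -> ptf (fun a => good_level (J a) (l a)).
Proof.
move=> lP; have hereP := ptime_Ahere JP; have nP := ptime_idim JP.
apply: ptime_FAnd; first exact: (ptime_functional JP lP).
apply: ptime_FAnd.
  exact: (ptime_some_at JP hereP lP (ptime_iota0 (ptime_card_idom JP))).
apply: ptime_FAnd; apply: ptime_FOr.
- exact: (ptime_onesx _ (ptime_colo JP) nP).
- exact: (ptime_pair_at JP hereP lP (ptime_Aright JP) lP (ptime_ihor JP)).
- exact: (ptime_onesx _ (ptime_rowo JP) nP).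
- exact: (ptime_pair_at JP hereP lP (ptime_Abelow JP) lP (ptime_iver JP)).
Qed.

End Game.

Section Output.

Variables (T : Type) (e : T -> tree) (J : T -> instance).
Hypothesis JP : ptime e (fun a => enc_instance (J a)).
Local Notation ptf f := (ptime e (fun a => enc_form (f a))).

Let JP' := ptime_fst enc_nat JP.
Let nP := ptime_idim JP.
Let dP := ptime_card_idom JP.

Lemma ptime_good_final : ptf (fun a => good_final (J a)).
Proof.
have predP : ptime e (fun a => enc_nat (idim (J a)).-1).
  by apply: ptime_ext (ptime_tail nP) => a; case: (idim (J a)).
apply: ptime_FAnd.
  apply: (ptime_bigand (eU := enc_nat)); first exact: ptime_iota0.
  exact: (ptime_good_level JP' (ptime_snd _ _)).
apply: ptime_FAnd.
  apply: (ptime_bigand (eU := enc_nat)); first exact: ptime_iota0.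
  have sP := ptime_snd e enc_nat; have hereP := ptime_Ahere JP'.
  exact: (ptime_pair_at JP' hereP sP hereP (ptime_succ sP) (ptime_imulti JP')).
exact: (ptime_some_at JP (ptime_Alast JP) predP (ptime_iacc JP)).
Qed.

Lemma ptime_mc_form : ptf (fun a => mc_form (J a)).
Proof.
apply/ptime_FNot/ptime_FAnd; first exact/ptime_FReg/ptime_rany.
apply: ptime_FNot.
pose V a l := valid l.+1 (idim (J a) - l.+1 + idim (J a)) (l.+1 + idim (J a) + #|idom (J a)|) (good_init (J a) l).
have VP : ptime (ext e enc_nat) (fun s => enc_form (V s.1 s.2)).
  have lP := ptime_snd e enc_nat.
  have nP' := ptime_fst enc_nat nP; have dP' := ptime_fst enc_nat dP.
  apply: (ptime_valid JP') (ptime_succ lP) _ _ _.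
  - exact: (ptime_addn (ptime_subn nP' (ptime_succ lP)) nP').
  - exact: (ptime_addn (ptime_addn (ptime_succ lP) nP') dP').
  - exact: (ptime_good_init JP' lP).
(* One step of the fold wraps the accumulator in [FNot], [FEbar] and [FAnd], whose tags are 1, 4 and
   2. *)
have lin := linear_comp1 (enc_nat 1) (linear_comp1 (enc_nat 4) (linear_enc2 (enc_nat 2))).
have FP : ptf (fun a => FEbar (valid (idim (J a)).+1 0
    (#|idom (J a)| + idim (J a) + idim (J a) + idim (J a)) (good_final (J a)))).
  apply: ptime_FEbar; apply: (ptime_valid (z := fun=> 0) JP) (ptime_succ nP) (ptime_leaf _) _ ptime_good_final.
  exact: (ptime_addn (ptime_addn (ptime_addn dP nP) nP) nP).
have := ptime_foldr (F := fun a l => enc_form (V a l)) lin (ptime_iota0 nP) VP FP.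
by apply: ptime_ext => a; rewrite /game; elim: (iota _ _) => //= l s ->.
Qed.

Lemma enum_bool : enum {: bool} = [:: true; false].
Proof. by rewrite enumT unlock. Qed.

Lemma ptime_mc_kripke : ptime e (fun a => enc_kripke (mc_kripke (J a))).
Proof.
(* The enumeration of [bool] starts with [true], the state labelled by [atom0], and the code of
   [atom0] is [Leaf]. The code of the structure is thus the same tree for all instances. *)
pose lab := enc_list [:: enc_list [:: Leaf]; enc_list [::]].
pose out := enc_list [:: enc_nat 2; enc_rel [set: bool * bool]; lab; enc_fin false].
apply: ptime_ext (ptime_const e out) => a.
by rewrite /enc_kripke /= card_bool enum_bool /= /enc_set enum_set1 enum_set0 /= enc_atom0.
Qed.

End Output.

Lemma polytime_reduction :
  polytime enc_instance (fun I => @enc_mc (AP_of (idom I))) (fun I => (mc_kripke I, mc_form I)).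
Proof.
have idP := ptime_id enc_instance.
have [p [g [[c [k gb]] H]]] := ptime_node (ptime_mc_kripke enc_instance id) (ptime_mc_form idP).
exists p, c, k => I; have [t rt tg] := H I; exists t; split=> //.
exact: leq_trans tg (leq_trans (gb I) (leq_addr _ _)).
Qed.

(** * Correctness of the reduction *)

(* Least significant bit first. *)
Fixpoint num m o (c : seq bool) : nat :=
  if m is m'.+1 then nth false c o + (num m' o.+1 c).*2 else 0.

Lemma num_lt m o c : num m o c < 2 ^ m.
Proof. by elim: m o => //= m IH o; have := IH o.+1; rewrite expnS; case: nth => /=; lia. Qed.

Lemma num_eq m o x y :
  num m o x = num m o y <-> forall q, o <= q < o + m -> nth false x q = nth false y q.
Proof.
elim: m o => [|m IH] o /=; first by split=> // _ q; lia.
split=> [E q qm|E].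
  have [E1 E2] : nth false x o = nth false y o /\ num m o.+1 x = num m o.+1 y.
    by case: (nth _ _ _) (nth _ _ _) E => -[] /=; lia.
  have [->//|oq] := eqVneq q o.
  by move/IH: E2; apply; lia.
rewrite (E o) ?leqnn; last lia.
by congr (_ + _.*2); apply/IH => q qm; apply: E; lia.
Qed.

Lemma num_ones m o x :
  (num m o x).+1 = 2 ^ m <-> forall q, o <= q < o + m -> nth false x q = true.
Proof.
elim: m o => [|m IH] o /=; first by split=> // _ q; lia.
have lt := num_lt m o.+1 x; rewrite expnS; split=> [E q qm|E].
  have [E1 E2] : nth false x o = true /\ (num m o.+1 x).+1 = 2 ^ m.
    by case: (nth _ _ _) E => /=; lia.
  have [->//|oq] := eqVneq q o.
  by move/IH: E2; apply; lia.
rewrite (E o); last lia.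
suff : (num m o.+1 x).+1 = 2 ^ m by rewrite /=; lia.
by apply/IH => q qm; apply: E; lia.
Qed.

(** Incrementing sets the lowest zero bit [p], clears the ones below it and keeps the bits above
    it. *)
Lemma num_succ m o x y :
  num m o y = (num m o x).+1 <-> exists p, [/\ p < m,
    nth false x (o + p) = false /\ nth false y (o + p) = true,
    forall q, o <= q < o + p -> nth false x q = true /\ nth false y q = false
    & forall q, o + p < q < o + m -> nth false x q = nth false y q].
Proof.
elim: m o => [|m IH] o /=; first by split=> // -[p []].
split=> [E|[[|p] [pm [xp yp] lo hi]]].
- case Ex: (nth false x o) E; case Ey: (nth false y o) => /= E; try lia.
    have [|p [pm [xp yp] lo hi]] := (IH o.+1).1; first lia.
    rewrite !addSnnS in xp yp; exists p.+1; split=> // q qm.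
      by have [->//|oq] := eqVneq q o; apply: lo; lia.
    by apply: hi; lia.
  have /num_eq E' : num m o.+1 x = num m o.+1 y by lia.
  exists 0; rewrite addn0; split=> // q qm; first lia.
  by apply: E'; lia.
- rewrite addn0 in xp yp hi; rewrite xp yp /=; congr (_ + _.*2).
  by apply/num_eq => q qm; rewrite hi //; lia.
- have [-> ->] : nth false x o = true /\ nth false y o = false by apply: lo; lia.
  rewrite /= (IH o.+1).2; first lia.
  rewrite -addSnnS in xp yp; exists p; split=> // q qm; first by apply: lo; lia.
  by apply: hi; lia.
Qed.

Fixpoint bits m i : seq bool :=
  if m is m'.+1 then odd i :: bits m' i./2 else [::].

Lemma size_bits m i : size (bits m i) = m.
Proof. by elim: m i => //= m IH i; rewrite IH. Qed.

Lemma num_bits m i s : i < 2 ^ m -> num m 0 (bits m i ++ s) = i.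
Proof.
have num_cons k o b t : num k o.+1 (b :: t) = num k o t.
  by elim: k o => //= k IH o; rewrite IH.
elim: m i => [|m IH] i /=; first by rewrite expn0; case: i.
rewrite expnS num_cons => im; rewrite IH ?odd_double_half //; lia.
Qed.

Lemma num_cat m o s t : num m (size s + o) (s ++ t) = num m o t.
Proof.
elim: m o => //= m IH o; rewrite nth_cat ltnNge leq_addr /= addKn.
by rewrite -addnS IH.
Qed.

(** * Semantics of formulas on boolean words *)

Section Semantics.

Variable I : instance.
Local Notation n := (idim I).
Local Notation d := #|idom I|.
Local Notation AP := (AP_of (idom I)).
Local Notation K := (mc_kripke I).
Local Notation W := (width I).

(** The two states have different labels, so a trace and its label word determine each other and
    languages can be read over boolean words. *)
Definition matches (r : regexp AP) (w : seq bool) : Prop :=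
  lang r [seq klabel (k := K) s | s <- w].
Definition holds (w : seq bool) (f : form AP) : Prop := @sat AP K w f.

Lemma matches_any w : matches (rany I) w <-> size w = 1.
Proof.
split=> [[A [wA _]]|]; first by rewrite -(size_map (klabel (k := K))) wA.
by case: w => [|b [|]] // _; exists (klabel (k := K) b).
Qed.

Lemma matches_lit b w : matches (rlit I b) w <-> w = [:: b].
Proof.
have litE c : psat (klabel (k := K) c) (if b then PAtom (atom0 (idom I)) else PNot (PAtom (atom0 (idom I)))) = (c == b).
  by case: b c => - [] /=; rewrite ?set11 ?inE.
split=> [[A []]|->]; last by exists (klabel (k := K) b); rewrite litE.
by case: w => [|c [|]] //= [<-]; rewrite litE => /eqP ->.
Qed.

Lemma matches_cat r s w :
  matches (RCat r s) w <-> exists w1 w2, [/\ w = w1 ++ w2, matches r w1 & matches s w2].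
Proof.
split=> [[v1 [v2 [wE rv sv]]]|[w1 [w2 [-> rw sw]]]]; last first.
  by exists [seq klabel (k := K) s | s <- w1], [seq klabel (k := K) s | s <- w2]; rewrite -map_cat.
exists (take (size v1) w), (drop (size v1) w); split; first by rewrite cat_take_drop.
  by rewrite /matches map_take wE take_size_cat.
by rewrite /matches map_drop wE drop_size_cat.
Qed.

Lemma matches_star r w :
  matches (RStar r) w <-> exists ws, w = flatten ws /\ forall v, v \in ws -> matches r v.
Proof.
split=> [[vs [wE rv]]|[ws [-> rw]]]; last first.
  exists [seq [seq klabel (k := K) s | s <- v] | v <- ws]; rewrite map_flatten.
  by split=> // v /mapP[v' v'ws ->]; apply: rw.
(* The factorisation of the label word is carried over to [w] through the lengths of the factors. *)
pose ws := reshape (shape vs) w.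
have vsE : [seq [seq klabel (k := K) s | s <- v] | v <- ws] = vs.
  by rewrite map_reshape wE flattenK.
exists ws; split.
  by rewrite reshapeKr // -size_flatten -wE size_map.
by move=> v vws; apply: rv; rewrite -vsE; apply: map_f.
Qed.

Lemma matches_pow_any k w : matches (rpow (rany I) k) w <-> size w = k.
Proof.
elim: k w => [|k IH] w.
  by split=> [|/size0nil ->] //; case: w.
rewrite /rpow iterS matches_cat; split=> [[w1 [w2 [-> /matches_any h1 /IH h2]]]|].
  by rewrite size_cat h1 h2.
case: w => // b w [wk]; exists [:: b], w; split=> //; first exact/matches_any.
exact/IH.
Qed.

Lemma matches_pow_lit k b w : matches (rpow (rlit I b) k) w <-> w = nseq k b.
Proof.
elim: k w => [|k IH] w.
  by split=> [|->] //; case: w.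
rewrite /rpow iterS matches_cat; split=> [[w1 [w2 [-> /matches_lit -> /IH ->]]] //|->].
by exists [:: b], (nseq k b); split=> //; [apply/matches_lit | apply/IH].
Qed.

Lemma holds_reg w r : holds w (FReg r) <-> matches r w. Proof. by []. Qed.
Lemma holds_not w f : holds w (FNot f) <-> ~ holds w f. Proof. by []. Qed.
Lemma holds_and w f g : holds w (FAnd f g) <-> holds w f /\ holds w g. Proof. by []. Qed.

Lemma holds_or w f g : holds w (FOr f g) <-> holds w f \/ holds w g.
Proof.
split=> /=; last by case=> h [h1 h2].
by move=> h; have [?|?] := classic (holds w f); [left | right; apply: NNPP => ?; apply: h].
Qed.

Lemma holds_true w : holds w (FTrue I).
Proof.
rewrite /FTrue holds_reg matches_star; exists [seq [:: b] | b <- w]; split; first by rewrite flatten_seq1.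
by move=> v /mapP[b _ ->]; apply/matches_any.
Qed.

Lemma holds_bigand (U : eqType) w (s : seq U) F :
  holds w (bigand s F) <-> forall u, u \in s -> holds w (F u).
Proof.
elim: s => [|u s IH]; first by split=> // _; apply: holds_true.
rewrite -[bigand _ _]/(FAnd (F u) (bigand s F)) holds_and IH; split=> [[hu hs] v|h].
  by rewrite inE => /predU1P[->|/hs].
by split=> [|v vs]; apply: h; rewrite inE ?eqxx ?vs ?orbT.
Qed.

Lemma holds_bigor (U : eqType) w (s : seq U) F :
  holds w (bigor s F) <-> exists u, u \in s /\ holds w (F u).
Proof.
elim: s => [|u s IH]; first by split=> [/(_ (holds_true w))|[u []]].
rewrite -[bigor _ _]/(FOr (F u) (bigor s F)) holds_or IH; split=> [[hu|[v [vs hv]]]|[v []]].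
- by exists u; rewrite inE eqxx.
- by exists v; rewrite inE vs orbT.
- by rewrite inE => /predU1P[->|vs hv]; [left | right; exists v].
Qed.

Lemma trace_neq0 (w : seq bool) : @trace AP K w = (w != [::]).
Proof.
case: w => //= b w; elim: w b => //= c w IH b; by rewrite IH in_setT.
Qed.

Lemma holds_Ebar w f : w != [::] ->
  holds w (FEbar f) <-> exists u, u != [::] /\ holds (u ++ w) f.
Proof.
move=> w0; split=> [[v [_ /and3P[_ vw /suffixP[u vE]] hv]]|[u [u0 hu]]].
  by exists u; rewrite -vE; split=> //; apply: contra vw => /eqP u0; rewrite vE u0.
exists (u ++ w); split=> //; first by rewrite trace_neq0; case: u u0 {hu}.
rewrite /Suff w0 suffix_suffix andbT; apply/eqP => /(congr1 size).
by rewrite size_cat; case: u u0 {hu} => //= b u _; lia.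
Qed.

Lemma holds_B w f :
  holds w (FB f) <-> exists v v', [/\ w = v ++ v', v != [::], v' != [::] & holds v f].
Proof.
split=> [[v [/and3P[v0 vw /prefixP[v' wE]] hv]]|[v [v' [-> v0 v'0 hv]]]].
  by exists v, v'; split=> //; apply: contra vw => /eqP v'0; rewrite wE v'0 cats0.
exists v; split=> //; rewrite /Pref v0 prefix_prefix andbT /=.
by apply/eqP => /(congr1 size); rewrite size_cat; case: v' v'0 => //= b u _; lia.
Qed.

Lemma holds_xbit w b q : holds w (xbit I b q) <-> q < size w /\ nth false w q = b.
Proof.
rewrite holds_reg matches_cat; split.
  move=> [w1 [w2 [-> /matches_pow_any sz /matches_cat[w3 [w4 [-> /matches_lit -> _]]]]]].
  by rewrite nth_cat !size_cat sz ltnn subnn /=; lia.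
move=> [qw <-]; exists (take q w), (drop q w); split; first by rewrite cat_take_drop.
  by apply/matches_pow_any; rewrite size_takel // ltnW.
rewrite (drop_nth false qw); apply/matches_cat.
exists [:: nth false w q], (drop q.+1 w); split=> //; first exact/matches_lit.
exact: holds_true.
Qed.

Lemma holds_ybit w b q : holds w (ybit I b q) <-> q < size w /\ nth false (rev w) q = b.
Proof.
rewrite holds_reg matches_cat; split.
  move=> [w1 [w2 [-> _ /matches_cat[w3 [w4 [-> /matches_lit -> /matches_pow_any sz]]]]]].
  rewrite !rev_cat !size_cat /= -catA nth_cat size_rev sz ltnn subnn /=; lia.
rewrite -(revK w) size_rev revK; set v := rev w => -[qw <-].
exists (rev (drop q.+1 v)), (nth false v q :: rev (take q v)); split.
- rewrite -cat_rcons -rev_cons -rev_cat -(drop_nth false qw) cat_take_drop //.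
- exact: holds_true.
apply/matches_cat; exists [:: nth false v q], (rev (take q v)); split=> //.
  exact/matches_lit.
by apply/matches_pow_any; rewrite size_rev size_takel // ltnW.
Qed.

(** * Words as lists of cells *)

Definition cell_ok y (c : seq bool) : Prop :=
  size c = W /\ forall q, y < q -> nth false c q = false.
Definition flag (c : seq bool) : bool := nth false c 0.
Definition encode (S : seq (seq bool)) (t : bool) : seq bool :=
  flatten [seq rev c | c <- S] ++ [:: t].
(** The flags count the blocks. The default [[:: true]] lets the empty list, with no block, pass the
    test on the first cell. *)
Definition shaped k y (S : seq (seq bool)) : Prop :=
  [/\ forall c, c \in S -> cell_ok y c, count flag S = k & flag (head [:: true] S)].

(** Cells are written in reverse, so the [z] leading zeros of [rcell] are the positions beyond [y],
    and the last letter is the flag. *)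
Lemma matches_cell z y b w : (z + y).+1 = W ->
  matches (rcell I z y b) w <-> cell_ok y (rev w) /\ flag (rev w) = b.
Proof.
move=> zyW; rewrite matches_cat; split.
  move=> [w1 [w2 [-> /matches_pow_lit -> /matches_cat[w3 [w4 [-> /matches_pow_any sz /matches_lit ->]]]]]].
  rewrite !rev_cat -catA /= rev_nseq; split=> //; split.
    by rewrite /= size_cat size_rev size_nseq; lia.
  move=> [|q] //= yq; rewrite nth_cat size_rev sz ltnNge -ltnS yq /= nth_nseq.
  by case: ifP.
move: (rev w) (revK w) => [|b' c] <- [[]] // szc c0 <-; rewrite /= in szc.
have {}c0 q : y <= q -> nth false c q = false by move=> yq; apply: (c0 q.+1).
exists (nseq z false), (rev (take y c) ++ [:: b']); split.
- rewrite rev_cons -cats1 catA; congr (_ ++ _).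
  rewrite -{1}(cat_take_drop y c) rev_cat; congr (_ ++ _).
  suff -> : drop y c = nseq z false by rewrite rev_nseq.
  apply: (@eq_from_nth _ false); first by rewrite size_drop size_nseq; lia.
  by move=> q _; rewrite nth_drop nth_nseq c0 ?if_same // leq_addr.
- exact/matches_pow_lit.
apply/matches_cat; exists (rev (take y c)), [:: b']; split=> //; last exact/matches_lit.
by apply/matches_pow_any; rewrite size_rev size_takel //; lia.
Qed.

(** Cuts a list just before its next flagged cell, which is where the current block ends. *)
Lemma split_flag S : exists A B, [/\ S = A ++ B, forall c, c \in A -> flag c = false
  & flag (head [:: true] B)].
Proof.
elim: S => [|c S [A [B [-> HA HB]]]]; first by exists [::], [::].
case fc: (flag c); first by exists [::], (c :: A ++ B).
by exists (c :: A), B; split=> // c'; rewrite inE => /predU1P[->|/HA].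
Qed.

Lemma matches_shape k z y w : (z + y).+1 = W ->
  matches (rshape I k z y) w <-> exists S t, w = encode S t /\ shaped k y S.
Proof.
move=> zyW; elim: k w => [|k IH] w.
  rewrite matches_any; split.
    by case: w => [|t [|]] // _; exists [::], t.
  by move=> [[|c S] [t [-> [_ /= c0 fc]]]] //; move: c0; rewrite fc.
rewrite /rshape iterS matches_cat; split.
  move=> [w1 [w2 [-> /(matches_cell _ _ zyW)[ok1 f1] /matches_cat[w3 [w4 [-> /matches_star[vs [-> vsP]]]]]]]].
  move=> /IH[S [t [-> [Sok Sk Sf]]]].
  have {}vsP v : v \in vs -> cell_ok y (rev v) /\ flag (rev v) = false.
    by move/vsP/(matches_cell _ _ zyW).
  exists (rev w1 :: [seq rev v | v <- vs] ++ S), t; split.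
    rewrite /encode /= revK map_cat flatten_cat -!catA -map_comp.
    by rewrite (_ : map _ vs = vs) // -[RHS]map_id; apply: eq_map => v /=; rewrite revK.
  split=> [c|/=|//].
    rewrite inE mem_cat => /predU1P[-> //|/orP[/mapP[v /vsP[okv _] ->] //|/Sok //]].
  rewrite f1 count_cat Sk add1n; congr _.+1.
  rewrite (_ : count _ _ = 0) //; apply/eqP; rewrite -leqn0 leqNgt -has_count.
  by apply/negP => /hasP[_ /mapP[v /vsP[_ fv] ->]]; rewrite fv.
move=> [[|c S1] [t [-> [Sok Sk Sf]]]] //; rewrite /= in Sf Sk.
have [A [B [S1E HA HB]]] := split_flag S1; subst S1.
exists (rev c), (encode (A ++ B) t); split; first by rewrite /encode /= catA.
  by apply/(matches_cell _ _ zyW); rewrite revK; split=> //; apply: Sok; rewrite inE eqxx.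
apply/matches_cat; exists (flatten [seq rev c | c <- A]), (encode B t); split.
- by rewrite /encode map_cat flatten_cat catA.
- apply/matches_star; exists [seq rev c | c <- A]; split=> // _ /mapP[v vA ->].
  apply/(matches_cell _ _ zyW); rewrite revK; split; last exact: HA.
  by apply: Sok; rewrite inE mem_cat vA orbT.
apply/IH; exists B, t; split=> //; split=> // [v vB|].
  by apply: Sok; rewrite inE mem_cat vB !orbT.
move: Sk; rewrite Sf count_cat (_ : count _ A = 0) => [[] //|].
by apply/eqP; rewrite -leqn0 leqNgt -has_count; apply/negP => /hasP[v /HA ->].
Qed.

(** All factors have the same positive length, so the two factorisations agree factor by factor. *)
Lemma flatten_prefix (A B : seq (seq bool)) v :
    (forall c, c \in A -> size c = W) -> (forall c, c \in B -> size c = W) ->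
    flatten A ++ v = flatten B ->
  exists C, B = A ++ C /\ v = flatten C.
Proof.
elim: A B => [|a A IH] [|b B] HA HB.
- by move=> /= ->; exists [::].
- by move=> /= ->; exists (b :: B).
- move/(congr1 size); rewrite /= !size_cat (HA a) ?inE ?eqxx //.
move=> /= /eqP; rewrite -catA eqseq_cat; last by rewrite HA ?HB // inE eqxx.
case/andP=> /eqP -> /eqP E; have [||C [-> ->]] := IH B _ _ E; last by exists C.
  by move=> c cA; apply: HA; rewrite inE cA orbT.
by move=> c cB; apply: HB; rewrite inE cB orbT.
Qed.

(** Reversing both words turns the suffix into a prefix and restores the orientation of each cell;
    unique factorisation then applies. *)
Lemma encode_suffix S0 t0 S t u :
    (forall c, c \in S0 -> size c = W) -> (forall c, c \in S -> size c = W) ->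
    u ++ encode S0 t0 = encode S t ->
  t = t0 /\ exists U, S = U ++ S0 /\ u = flatten [seq rev c | c <- U].
Proof.
have revE T : rev (flatten [seq rev c | c <- T]) = flatten (rev T).
  rewrite rev_flatten -map_comp; congr (flatten (rev _)).
  by rewrite -[RHS]map_id; apply: eq_map => c /=; rewrite revK.
move=> H0 H /(congr1 rev); rewrite /encode !rev_cat !revE /= => -[<- E]; split=> //.
have [||C [SE vE]] := flatten_prefix _ _ E.
- by move=> c; rewrite mem_rev; apply: H0.
- by move=> c; rewrite mem_rev; apply: H.
exists (rev C); split; first by rewrite -(revK S) SE rev_cat revK.
by rewrite -(revK u) vE -{1}(revK C) -revE revK.
Qed.

(** The shape of the whole word, parsed from its right end, forces [u] to be a list of cells. The
    inner [FEbar] then ranges exactly over the single cells [x], since the number of flags behind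
    the marker is prescribed. *)
Lemma holds_valid k z y G S0 u : (z + y).+1 = W -> (forall c, c \in S0 -> size c = W) ->
  holds (u ++ encode S0 false) (valid k z y G) <->
  exists U, [/\ u = flatten [seq rev c | c <- U], shaped k y (U ++ S0)
    & forall x, size x = W -> holds (x ++ encode (U ++ S0) false) G].
Proof.
move=> zyW H0; have sz_ok (S : seq (seq bool)) : (forall c, c \in S -> cell_ok y c) -> forall c, c \in S -> size c = W.
  by move=> H c /H[].
have enc_cat U : flatten [seq rev c | c <- U] ++ encode S0 false = encode (U ++ S0) false.
  by rewrite /encode map_cat flatten_cat catA.
rewrite holds_and holds_reg matches_shape // holds_not.
have Ebar S : shaped k y S ->
    ~ holds (encode S false) (FEbar (FAnd (FReg (RCat (rpow (rany I) W) (rshape I k z y))) (FNot G))) <->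
    forall x, size x = W -> holds (x ++ encode S false) G.
  move=> sS; rewrite holds_Ebar; last by rewrite /encode -size_eq0 size_cat addn1.
  split=> [H x szx|H [v [v0 []]]].
    apply: NNPP => nG; apply: H; exists x; split; first by rewrite -size_eq0 szx.
    rewrite holds_and holds_reg holds_not; split=> //.
    apply/matches_cat; exists x, (encode S false); split=> //.
      exact/matches_pow_any.
    by apply/(matches_shape _ _ zyW); exists S, false.
  move/matches_cat=> [x [w [vE /matches_pow_any szx /(matches_shape _ _ zyW)[S' [t [wE sS']]]]]]; apply.
  have [Sok Sk Sf] := sS; have [Sok' Sk' Sf'] := sS'.
  have [|||_ [[|c U] [SE vE']]] := @encode_suffix S false (rev x :: S') t v.
  - exact: (sz_ok _ Sok).
  - by move=> c; rewrite inE => /predU1P[->|/(sz_ok _ Sok')//]; rewrite size_rev.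
  - by rewrite vE wE /encode /= revK catA.
    by rewrite vE' in v0.
  case: SE => xc S'E; suff U0 : U = [::].
    by apply: H; rewrite vE' U0 -xc /= cats0 revK.
  (* A second pushed cell would be the head of [S'], hence flagged, in addition to the [k] flags of
     [S]. *)
  case: U S'E {vE'} => // c' U S'E; move: Sk'; rewrite S'E in Sf' *.
  by rewrite /= in Sf'; rewrite /= Sf' count_cat Sk; lia.
split=> [[[S [t [wE sS]]] H]|[U [uE sS H]]].
  have [Sok _ _] := sS.
  have [|t0 [U [SE uE]]] := encode_suffix H0 _ wE; first exact: (sz_ok _ Sok).
  exists U; split=> //; first by rewrite -SE.
  by rewrite -SE -Ebar // SE -enc_cat -uE.
rewrite uE enc_cat; split; first by exists (U ++ S0), false.
exact/Ebar.
Qed.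

(** A prefix formed by the marker and at least one further block of width [W] ends exactly at a cell
    of [S]. By the last hypothesis, [A] sees only the two ends of that prefix, whatever the middle
    part [m] is. *)
Lemma holds_at_cell A l a (P : seq bool -> Prop) x S t :
    l < n -> a < d -> size x = W -> (forall c, c \in S -> size c = W) ->
    (forall m c, size c = W -> holds (x ++ m ++ rev c) A <-> P c) ->
  holds (x ++ encode S t) (at_cell A l a) <->
  exists c, [/\ c \in S, nth false c (levo I + l), nth false c a.+1 & P c].
Proof.
move=> ln ad szx HS HA.
have ybitE m c q b : size c = W -> q < W -> holds (x ++ m ++ rev c) (ybit I b q) <-> nth false c q = b.
  move=> szc qW; rewrite holds_ybit !rev_cat revK -catA nth_cat szc qW.
  by split=> [[]|->] //; split=> //; rewrite !size_cat size_rev; lia.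
have lW : levo I + l < W by rewrite /levo /width; lia.
have aW : a.+1 < W by rewrite /width; lia.
rewrite holds_B; split.
  move=> [v [v' [E _ v'0]]]; rewrite !holds_and holds_reg.
  move=> [/matches_cat[v1 [w [vE /matches_pow_any sz1 /matches_cat[v2 [w' [wE /matches_pow_any sz2 /matches_star[vs [w'E vsP]]]]]]]] H].
  move: E; rewrite vE -catA => /eqP; rewrite eqseq_cat ?szx ?sz1 // => /andP[/eqP xE /eqP E].
  (* The prefix is proper, so it leaves out the last letter [t], and the rest of it is a prefix of
     the cells alone. *)
  case/lastP: v' v'0 E => // v' t' _; rewrite /encode -cats1 catA !cats1 => /rcons_inj[E _].
  have szS c : c \in [seq rev c | c <- S] -> size c = W.
    by move=> /mapP[c' /HS szc ->]; rewrite size_rev.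
  have szv c : c \in v2 :: vs -> size c = W.
    by rewrite inE => /predU1P[-> //|/vsP/matches_pow_any].
  have [|C [SE _]] := flatten_prefix (v := v') szv szS; first by rewrite E wE w'E.
  have : last v2 vs \in [seq rev c | c <- S] by rewrite SE mem_cat mem_last.
  case/mapP=> c cS cE.
  move: H; have -> : v = x ++ flatten (belast v2 vs) ++ rev c.
    by rewrite vE -xE -cE -flatten_rcons -lastI wE w'E.
  by rewrite (ybitE _ _ _ _ (HS _ cS) lW) (ybitE _ _ _ _ (HS _ cS) aW) HA ?HS // => -[? []]; exists c.
move=> [c [cS lc ac Pc]]; have szc := HS _ cS; case/splitPr: cS HS => A' B' HS.
(* The prefix that stops right after the cell [c]. *)
exists (x ++ flatten [seq rev c | c <- A'] ++ rev c), (encode B' t); split.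
- by rewrite /encode map_cat flatten_cat /= -!catA.
- by rewrite -size_eq0 size_cat szx.
- by rewrite -size_eq0 size_cat addn1.
rewrite !holds_and (ybitE _ _ _ _ szc lW) (ybitE _ _ _ _ szc aW) HA //; split=> //.
rewrite holds_reg matches_cat; exists x, (flatten (rcons [seq rev c | c <- A'] (rev c))).
split; [by rewrite flatten_rcons | exact/matches_pow_any|].
have: forall v, v \in rcons [seq rev c | c <- A'] (rev c) -> size v = W.
  move=> v; rewrite mem_rcons inE => /predU1P[->|/mapP[c' c'A ->]]; rewrite size_rev //.
  by apply: HS; rewrite mem_cat c'A.
have : rcons [seq rev c | c <- A'] (rev c) != [::] by rewrite -size_eq0 size_rcons.
case: (rcons _ _) => // v2 vs _ szv; apply/matches_cat; exists v2, (flatten vs); split=> //.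
  by apply/matches_pow_any/szv; rewrite inE eqxx.
apply/matches_star; exists vs; split=> // v vvs.
by apply/matches_pow_any/szv; rewrite inE vvs orbT.
Qed.

(** * Comparing the address of the marker with that of a cell *)

Section FieldTests.

Variables (x c m : seq bool).
Hypotheses (szx : size x = W) (szc : size c = W).
Local Notation w := (x ++ m ++ rev c).

Lemma holds_xbit_cell b q : q < W -> holds w (xbit I b q) <-> nth false x q = b.
Proof.
move=> qW; rewrite holds_xbit nth_cat szx qW.
by split=> [[]|->] //; split=> //; rewrite size_cat; lia.
Qed.

Lemma holds_ybit_cell b q : q < W -> holds w (ybit I b q) <-> nth false c q = b.
Proof.
move=> qW; rewrite holds_ybit !rev_cat revK -catA nth_cat szc qW.
by split=> [[]|->] //; split=> //; rewrite !size_cat size_rev; lia.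
Qed.

Lemma holds_eq_bit q : q < W -> holds w (eq_bit I q) <-> nth false x q = nth false c q.
Proof.
move=> qW; rewrite holds_or !holds_and !holds_xbit_cell // !holds_ybit_cell //.
by case: (nth _ _ _) (nth _ _ _) => -[]; intuition.
Qed.

Lemma holds_eq_field o k : o + k <= W -> holds w (eq_field I o k) <-> num k o x = num k o c.
Proof.
move=> okW; rewrite holds_bigand num_eq.
split=> [H q qok|H q]; first by rewrite -holds_eq_bit; [apply: H; rewrite mem_iota | lia].
by rewrite mem_iota => qok; rewrite holds_eq_bit; [apply: H | lia].
Qed.

Lemma holds_succ_field o k : o + k <= W ->
  holds w (succ_field I o k) <-> num k o c = (num k o x).+1.
Proof.
move=> okW; rewrite holds_bigor num_succ.
have bitsE b b' q : q < W -> holds w (bits_are I b b' q) <-> nth false x q = b /\ nth false c q = b'.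
  by move=> qW; rewrite holds_and holds_xbit_cell // holds_ybit_cell.
split=> [[p []]|[p [pk xy lo hi]]].
  rewrite mem_iota => /andP[_ pk]; rewrite holds_and bitsE ?holds_and; last lia.
  rewrite !holds_bigand => -[xy [lo hi]]; exists p; split=> // q qp.
    by apply/bitsE; [lia | apply: lo; rewrite mem_iota; lia].
  by apply/holds_eq_bit; [lia | apply: hi; rewrite mem_iota; lia].
exists p; rewrite mem_iota; split=> //; rewrite holds_and bitsE ?holds_and; last lia.
rewrite !holds_bigand; split=> //; split=> q; rewrite mem_iota => qp.
  by apply/bitsE; [lia | apply: lo; lia].
by apply/holds_eq_bit; [lia | apply: hi; lia].
Qed.

Lemma holds_onesy o k : o + k <= W -> holds w (onesy I o k) <-> (num k o c).+1 = 2 ^ k.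
Proof.
move=> okW; rewrite holds_bigand num_ones.
split=> [H q qok|H q]; first by rewrite -holds_ybit_cell; [apply: H; rewrite mem_iota | lia].
by rewrite mem_iota => qok; rewrite holds_ybit_cell; [apply: H | lia].
Qed.

End FieldTests.

(** * Facts stated by a list of cells *)

Local Notation colnum c := (num n (colo I) c).
Local Notation rownum c := (num n (rowo I) c).

Lemma holds_onesx x v o k : size x = W -> o + k <= W ->
  holds (x ++ v) (onesx I o k) <-> (num k o x).+1 = 2 ^ k.
Proof.
move=> szx okW; rewrite holds_bigand num_ones.
have xE q : q < W -> holds (x ++ v) (xbit I true q) <-> nth false x q = true.
  move=> qW; rewrite holds_xbit nth_cat szx qW size_cat szx.
  by split=> [[]|] // ->; split=> //; lia.
split=> [H q qok|H q]; first by rewrite -xE; [apply: H; rewrite mem_iota | lia].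
by rewrite mem_iota => qok; rewrite xE; [apply: H | lia].
Qed.

(** Only one level bit and one type bit are inspected. An arbitrary cell, whose fields need not be
    one-hot, may therefore state several facts or none; conflicting types are excluded by
    [single_valued]. *)
Definition tile_at (S : seq (seq bool)) l i j a : bool :=
  has (fun c => [&& nth false c (levo I + l), nth false c a.+1,
    rownum c == i & colnum c == j]) S.

Lemma tile_atP S l i j a : reflect
  (exists c, [/\ c \in S, nth false c (levo I + l), nth false c a.+1 & rownum c = i /\ colnum c = j])
  (tile_at S l i j a).
Proof.
apply: (iffP hasP) => [[c cS /and4P[lc ac /eqP ic /eqP jc]]|[c [cS lc ac [ic jc]]]].
  by exists c.
by exists c => //; rewrite lc ac ic jc !eqxx.
Qed.

Lemma tile_at_cat S S' l i j a : tile_at (S ++ S') l i j a = tile_at S l i j a || tile_at S' l i j a.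
Proof. exact: has_cat. Qed.

Lemma tile_at_lt S l i j a : tile_at S l i j a -> i < 2 ^ n /\ j < 2 ^ n.
Proof. by case/tile_atP=> c [_ _ _ [<- <-]]; rewrite !num_lt. Qed.

Section MarkedCells.

Variables (x : seq bool) (S : seq (seq bool)) (t : bool).
Hypotheses (szx : size x = W) (szS : forall c, c \in S -> size c = W).
Variables (l a : nat).
Hypotheses (ln : l < n) (ad : a < d).
Local Notation w := (x ++ encode S t).

Let rowW : rowo I + n <= W. Proof. by rewrite /rowo /width; lia. Qed.
Let colW : colo I + n <= W. Proof. by rewrite /colo /width; lia. Qed.

Lemma holds_here :
  holds w (at_cell (Ahere I) l a) <-> tile_at S l (rownum x) (colnum x) a.
Proof.
rewrite (@holds_at_cell _ _ _ (fun c => rownum c = rownum x /\ colnum c = colnum x)) //.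
  exact: rwP (tile_atP _ _ _ _ _).
by move=> m c szc; rewrite holds_and !holds_eq_field //; intuition.
Qed.

Lemma holds_right :
  holds w (at_cell (Aright I) l a) <-> tile_at S l (rownum x) (colnum x).+1 a.
Proof.
rewrite (@holds_at_cell _ _ _ (fun c => rownum c = rownum x /\ colnum c = (colnum x).+1)) //.
  exact: rwP (tile_atP _ _ _ _ _).
by move=> m c szc; rewrite holds_and holds_eq_field // holds_succ_field //; intuition.
Qed.

Lemma holds_below :
  holds w (at_cell (Abelow I) l a) <-> tile_at S l (rownum x).+1 (colnum x) a.
Proof.
rewrite (@holds_at_cell _ _ _ (fun c => rownum c = (rownum x).+1 /\ colnum c = colnum x)) //.
  exact: rwP (tile_atP _ _ _ _ _).
by move=> m c szc; rewrite holds_and holds_eq_field // holds_succ_field //; intuition.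
Qed.

Lemma holds_col :
  holds w (at_cell (Acol I) l a) <-> exists i, tile_at S l i (colnum x) a.
Proof.
rewrite (@holds_at_cell _ _ _ (fun c => colnum c = colnum x)) //; last first.
  by move=> m c szc; rewrite holds_eq_field //; intuition.
split=> [[c [cS lc ac xc]]|[i /tile_atP[c [cS lc ac [_ xc]]]]]; last by exists c.
by exists (rownum c); apply/tile_atP; exists c.
Qed.

Lemma holds_last :
  holds w (at_cell (Alast I) l a) <-> exists i j, i.+1 = 2 ^ n /\ tile_at S l i j a.
Proof.
rewrite (@holds_at_cell _ _ _ (fun c => (rownum c).+1 = 2 ^ n)) //; last first.
  by move=> m c szc; rewrite holds_onesy.
split=> [[c [cS lc ac xc]]|[i [j [iN /tile_atP[c [cS lc ac [ci _]]]]]]].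
  by exists (rownum c), (colnum c); split=> //; apply/tile_atP; exists c.
by exists c; split=> //; rewrite ci.
Qed.

End MarkedCells.

(** * Building cells from tiles *)

Definition onehot k m : seq bool := [seq q == k | q <- iota 0 m].
Definition mkcell (b : bool) a j l i : seq bool :=
  b :: onehot a d ++ bits n j ++ onehot l n ++ bits n i.

Lemma size_onehot k m : size (onehot k m) = m.
Proof. by rewrite size_map size_iota. Qed.

Lemma nth_onehot k m q : q < m -> nth false (onehot k m) q = (q == k).
Proof. by move=> qm; rewrite (nth_map 0) ?size_iota // nth_iota. Qed.

Lemma size_mkcell b a j l i : size (mkcell b a j l i) = W.
Proof. by rewrite /= !size_cat !size_onehot !size_bits !addnA. Qed.

Lemma mkcell_type b a j l i a' : a' < d -> nth false (mkcell b a j l i) a'.+1 = (a' == a).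
Proof. by move=> ad; rewrite /= nth_cat size_onehot ad nth_onehot. Qed.

Lemma mkcell_level b a j l i l' : l' < n ->
  nth false (mkcell b a j l i) (levo I + l') = (l' == l).
Proof.
move=> ln; rewrite /levo addSn /= catA nth_cat size_cat size_onehot size_bits.
by rewrite ltnNge leq_addr addKn /= nth_cat size_onehot ln nth_onehot.
Qed.

Lemma mkcell_col b a j l i : j < 2 ^ n -> colnum (mkcell b a j l i) = j.
Proof.
move=> jn; have -> : colo I = size (b :: onehot a d) + 0 by rewrite /= size_onehot addn0.
by rewrite /mkcell -cat_cons num_cat num_bits.
Qed.

Lemma mkcell_row b a j l i : i < 2 ^ n -> rownum (mkcell b a j l i) = i.
Proof.
move=> i_n; have -> : rowo I = size (b :: (onehot a d ++ bits n j) ++ onehot l n) + 0.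
  by rewrite /= !size_cat !size_onehot size_bits addn0.
rewrite /mkcell 2!catA -cat_cons num_cat -[bits n i]cats0 num_bits //.
Qed.

(** The bound [l.+1 + n + d] is the position of the level bit; beyond it come the other zeros of the
    one-hot level and the bits of row 0. *)
Lemma mkcell_ok b a j l : cell_ok (l.+1 + n + d) (mkcell b a j l 0).
Proof.
split=> [|[|q] //=]; first exact: size_mkcell.
rewrite ltnS => lq; rewrite catA nth_cat size_cat size_onehot size_bits ltnNge.
rewrite (_ : d + n <= q) /=; last lia.
rewrite nth_cat size_onehot; case: ifP => [qn|_]; first by rewrite nth_onehot //; lia.
elim: (n) (_ - _) => [|k IH] [|r] //=; exact: IH.
Qed.

Lemma cell_ok_full c : size c = W -> cell_ok (d + n + n + n) c.
Proof. by move=> szc; split=> // q qy; rewrite nth_default // szc. Qed.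

(** Level, row, column and type, in the order of the arguments of [tile_at] rather than in the order
    of the bit layout. *)
Definition key := (nat * nat * nat * nat)%type.
Definition key_cell b (k : key) : seq bool := let: (l, i, j, a) := k in mkcell b a j l i.
Definition block (ks : seq key) : seq (seq bool) :=
  if ks is k :: ks' then key_cell true k :: [seq key_cell false k | k <- ks'] else [::].

Definition key_ok (k : key) : Prop :=
  let: (l, i, j, a) := k in [/\ l < n, i < 2 ^ n, j < 2 ^ n & a < d].

Lemma mem_block ks c : c \in block ks -> exists b k, k \in ks /\ c = key_cell b k.
Proof.
case: ks => //= k ks; rewrite inE => /predU1P[->|/mapP[k' k'ks ->]].
  by exists true, k; rewrite inE eqxx.
by exists false, k'; rewrite inE k'ks orbT.
Qed.

Lemma block_mem ks k : k \in ks -> exists b, key_cell b k \in block ks.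
Proof.
case: ks => //= k' ks; rewrite inE => /predU1P[->|kks].
  by exists true; rewrite inE eqxx.
by exists false; rewrite inE map_f ?orbT.
Qed.

Lemma tile_at_block ks l i j a :
    (forall k, k \in ks -> key_ok k) -> l < n -> a < d ->
  tile_at (block ks) l i j a <-> (l, i, j, a) \in ks.
Proof.
move=> ksP ln ad; split.
  case/tile_atP=> _ [/mem_block[b [[[[l' i'] j'] a'] [kks ->]]]].
  have [_ in_ jn _] := ksP _ kks.
  rewrite mkcell_level // mkcell_type // mkcell_row // mkcell_col //.
  by move=> /eqP -> /eqP -> [<- <-].
move=> kks; have [_ in_ jn _] := ksP _ kks.
have [b bP] := block_mem kks; apply/tile_atP; exists (key_cell b (l, i, j, a)).
by rewrite mkcell_level // mkcell_type // mkcell_row // mkcell_col // !eqxx.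
Qed.

Lemma shaped_block k y y' S ks :
    shaped k y' S -> y' <= y -> ks != [::] ->
    (forall b k, k \in ks -> cell_ok y (key_cell b k)) ->
  shaped k.+1 y (block ks ++ S).
Proof.
move=> [Sok Sk Sf] yy ks0 ksP; split.
- move=> c; rewrite mem_cat => /orP[/mem_block[b [k' [k'ks ->]]]|/Sok[szc c0]]; first exact: ksP.
  by split=> // q yq; apply: c0; apply: leq_ltn_trans yq.
- rewrite count_cat Sk; case: ks ks0 {ksP} => //= -[[[l i] j] a] ks _.
  by rewrite count_map (eq_count (a2 := pred0)) ?count_pred0 // => -[[[? ?] ?] ?].
- by case: ks ks0 {ksP} => //= -[[[l i] j] a] ks _.
Qed.

Definition rank (y : idom I) : nat := enum_rank y.

Lemma rank_lt y : rank y < d. Proof. exact: ltn_ord. Qed.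

Lemma rank_inj : injective rank.
Proof. by move=> y y' /val_inj/enum_rank_inj. Qed.

Lemma rank_surj a : a < d -> exists y, rank y = a.
Proof. by move=> ad; exists (enum_val (Ordinal ad)); rewrite /rank enum_valK. Qed.

Lemma ranksP (A : {set idom I}) a : a \in ranks A <-> exists y, y \in A /\ a = rank y.
Proof.
split=> [/mapP[y yA ->]|[y [yA ->]]]; last by apply: map_f; rewrite mem_enum.
by exists y; rewrite -mem_enum.
Qed.

Lemma pair_ranksP (A : {set idom I * idom I}) ab :
  ab \in pair_ranks A <-> exists y, y \in A /\ ab = (rank y.1, rank y.2).
Proof.
split=> [/mapP[y yA ->]|[y [yA ->]]]; last by apply: map_f; rewrite mem_enum.
by exists y; rewrite -mem_enum.
Qed.

(** * Meaning of the conditions checked by the marker *)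

Definition single_valued S : Prop := forall l i j y y', l < n ->
  tile_at S l i j (rank y) -> tile_at S l i j (rank y') -> y = y'.

Definition final_ok S : Prop :=
  [/\ single_valued S,
      forall l i j, l < n -> i < 2 ^ n -> j < 2 ^ n ->
        [/\ exists y, tile_at S l i j (rank y),
            j.+1 = 2 ^ n \/ exists y, [/\ y \in ihor I,
              tile_at S l i j (rank y.1) & tile_at S l i j.+1 (rank y.2)]
          & i.+1 = 2 ^ n \/ exists y, [/\ y \in iver I,
              tile_at S l i j (rank y.1) & tile_at S l i.+1 j (rank y.2)]],
      forall l i j, l.+1 < n -> i < 2 ^ n -> j < 2 ^ n ->
        exists y, [/\ y \in imulti I, tile_at S l i j (rank y.1) & tile_at S l.+1 i j (rank y.2)]
    & exists y i j, [/\ y \in iacc I, i.+1 = 2 ^ n & tile_at S n.-1 i j (rank y)]].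

Section GoodCells.

Variables (S : seq (seq bool)) (t : bool).
Hypothesis szS : forall c, c \in S -> size c = W.

Let rowW : rowo I + n <= W. Proof. by rewrite /rowo /width; lia. Qed.
Let colW : colo I + n <= W. Proof. by rewrite /colo /width; lia. Qed.

Lemma holds_functional x l : size x = W -> l < n ->
  holds (x ++ encode S t) (functional I l) <->
  forall y y', tile_at S l (rownum x) (colnum x) (rank y) ->
    tile_at S l (rownum x) (colnum x) (rank y') -> y = y'.
Proof.
move=> szx ln; rewrite holds_bigand; split=> [H|H a].
  (* The formula compares only types [b < a], which excludes one strict inequality; exchanging [y]
     and [y'] excludes the other. *)
  suff lt y y' : tile_at S l (rownum x) (colnum x) (rank y) ->
      tile_at S l (rownum x) (colnum x) (rank y') -> rank y <= rank y'.
    by move=> y y' ty ty'; apply: rank_inj; apply/eqP; rewrite eqn_leq !lt.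
  move=> ty ty'; rewrite leqNgt; apply/negP => yy'.
  have := H (rank y); rewrite mem_iota rank_lt => /(_ isT)/holds_bigand/(_ (rank y')).
  rewrite mem_iota yy' => /(_ isT); rewrite holds_not holds_and.
  by apply; rewrite !holds_here // rank_lt.
rewrite mem_iota => /andP[_ ad]; apply/holds_bigand => b.
rewrite mem_iota => /andP[_ ba]; have bd := ltn_trans ba ad.
rewrite holds_not holds_and !holds_here // => -[].
have [y ya] := rank_surj ad; have [y' y'b] := rank_surj bd.
by rewrite -ya -y'b in ba * => ty ty'; rewrite (H _ _ ty ty') ltnn in ba.
Qed.

Lemma holds_functionals :
  (forall x, size x = W -> forall l, l < n -> holds (x ++ encode S t) (functional I l)) <->
  single_valued S.
Proof.
split=> [H l i j y y' ln ty|H x szx l ln]; last first.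
  by apply/holds_functional => // y y'; apply: H.
have [i_n jn] := tile_at_lt ty.
(* The marker is a cell at address [(i, j)]; only its address is read. *)
have := H _ (size_mkcell false 0 j 0 i) _ ln.
rewrite holds_functional ?size_mkcell // mkcell_row // mkcell_col //.
by move/(_ _ y' ty).
Qed.

Lemma holds_good_init l : l < n ->
  (forall x, size x = W -> holds (x ++ encode S t) (good_init I l)) <->
  (forall j, j < 2 ^ n -> exists y i, y \in iinit I /\ tile_at S l i j (rank y)) /\
  single_valued S.
Proof.
move=> ln.
have initE x : size x = W -> holds (x ++ encode S t) (some_at (Acol I) l (ranks (iinit I))) <->
    exists y i, y \in iinit I /\ tile_at S l i (colnum x) (rank y).
  move=> szx; rewrite holds_bigor; split.
    move=> [_ [/ranksP[y [yD ->]]]]; rewrite holds_col ?rank_lt // => -[i ti].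
    by exists y, i.
  move=> [y [i [yD ti]]]; exists (rank y); split; first by apply/ranksP; exists y.
  by apply/holds_col; rewrite ?rank_lt //; exists i.
rewrite -holds_functionals; split=> [H|[H1 H2] x szx].
  split=> [j jn|x szx l' l'n].
    have szm := size_mkcell false 0 j 0 0; have [/(initE _ szm)] := H _ szm.
    by rewrite mkcell_col.
  by have [_ /holds_bigand] := H _ szx; apply; rewrite mem_iota.
rewrite holds_and holds_bigand; split; first by apply/initE => //; apply: H1; apply: num_lt.
by move=> l'; rewrite mem_iota => /andP[_ l'n]; apply: H2.
Qed.

Lemma holds_good_final :
  (forall x, size x = W -> holds (x ++ encode S t) (good_final I)) <-> final_ok S.
Proof.
have n_gt0 := idim_gt0 I; have predn : n.-1 < n by rewrite prednK.
have pairE x A A' l l' (R : {set idom I * idom I}) (T T' : nat -> bool) :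
    (forall a, a < d -> holds (x ++ encode S t) (at_cell A l a) <-> T a) ->
    (forall a, a < d -> holds (x ++ encode S t) (at_cell A' l' a) <-> T' a) ->
    holds (x ++ encode S t) (pair_at A l A' l' (pair_ranks R)) <->
    exists y, [/\ y \in R, T (rank y.1) & T' (rank y.2)].
  move=> HA HA'; rewrite holds_bigor; split.
    move=> [_ [/pair_ranksP[y [yR ->]]]]; rewrite holds_and HA ?rank_lt // HA' ?rank_lt //.
    by move=> []; exists y.
  move=> [y [yR Ty T'y]]; exists (rank y.1, rank y.2); split; first by apply/pair_ranksP; exists y.
  by rewrite holds_and HA ?rank_lt // HA' ?rank_lt.
have levelE x l : size x = W -> l < n -> holds (x ++ encode S t) (good_level I l) <->
   [/\ holds (x ++ encode S t) (functional I l), exists y, tile_at S l (rownum x) (colnum x) (rank y),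
     (colnum x).+1 = 2 ^ n \/ exists y, [/\ y \in ihor I,
        tile_at S l (rownum x) (colnum x) (rank y.1) & tile_at S l (rownum x) (colnum x).+1 (rank y.2)]
     & (rownum x).+1 = 2 ^ n \/ exists y, [/\ y \in iver I,
        tile_at S l (rownum x) (colnum x) (rank y.1) & tile_at S l (rownum x).+1 (colnum x) (rank y.2)]].
  move=> szx ln; rewrite /good_level !holds_and !holds_or !holds_onesx //.
  rewrite (pairE _ _ _ _ _ _ (tile_at S l (rownum x) (colnum x)) (tile_at S l (rownum x) (colnum x).+1)).
  - rewrite (pairE _ _ _ _ _ _ (tile_at S l (rownum x) (colnum x)) (tile_at S l (rownum x).+1 (colnum x))).
    + have -> : holds (x ++ encode S t) (some_at (Ahere I) l (iota 0 d)) <->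
          exists y, tile_at S l (rownum x) (colnum x) (rank y).
        rewrite holds_bigor; split=> [[a []]|[y ty]].
          rewrite mem_iota => /andP[_ ad]; rewrite holds_here //.
          by have [y <-] := rank_surj ad; exists y.
        by exists (rank y); rewrite mem_iota rank_lt holds_here ?rank_lt.
      by split=> [[? [? []]]|[]].
    + by move=> a ad; apply: holds_here.
    + by move=> a ad; apply: holds_below.
  - by move=> a ad; apply: holds_here.
  - by move=> a ad; apply: holds_right.
have multiE x l : size x = W -> l.+1 < n ->
    holds (x ++ encode S t) (pair_at (Ahere I) l (Ahere I) l.+1 (pair_ranks (imulti I))) <->
    exists y, [/\ y \in imulti I, tile_at S l (rownum x) (colnum x) (rank y.1)
      & tile_at S l.+1 (rownum x) (colnum x) (rank y.2)].
  move=> szx ln; apply: pairE => a ad; apply: holds_here => //; exact: ltnW.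
have accE x : size x = W -> holds (x ++ encode S t) (some_at (Alast I) n.-1 (ranks (iacc I))) <->
    exists y i j, [/\ y \in iacc I, i.+1 = 2 ^ n & tile_at S n.-1 i j (rank y)].
  move=> szx; rewrite holds_bigor; split.
    move=> [_ [/ranksP[y [yD ->]]]]; rewrite holds_last ?rank_lt // => -[i [j [iN tij]]].
    by exists y, i, j.
  move=> [y [i [j [yD iN tij]]]]; exists (rank y); split; first by apply/ranksP; exists y.
  by apply/holds_last; rewrite ?rank_lt //; exists i, j.
split=> [H|[Hf Hl Hm Ha] x szx].
  have szm i j := size_mkcell false 0 j 0 i.
  split.
  - apply/holds_functionals => x szx l ln; have [/holds_bigand Hl _] := H _ szx.
    have /levelE[] // : holds (x ++ encode S t) (good_level I l).
    by apply: Hl; rewrite mem_iota.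
  - move=> l i j ln i_n jn; have [/holds_bigand Hl _] := H _ (szm i j).
    have /levelE : holds (mkcell false 0 j 0 i ++ encode S t) (good_level I l).
      by apply: Hl; rewrite mem_iota.
    by rewrite mkcell_row // mkcell_col // => -[].
  - move=> l i j ln i_n jn; have [_ [/holds_bigand Hm _]] := H _ (szm i j).
    have /multiE : holds (mkcell false 0 j 0 i ++ encode S t)
        (pair_at (Ahere I) l (Ahere I) l.+1 (pair_ranks (imulti I))).
      by apply: Hm; rewrite mem_iota; lia.
    by rewrite mkcell_row // mkcell_col //; apply.
  - by have [_ [_ /accE]] := H _ (szm 0 0); apply.
rewrite /good_final !holds_and accE // !holds_bigand; split; [|split=> //] => l; rewrite mem_iota => /andP[_ ln].
  apply/levelE => //; have [? ? ?] := Hl l _ _ ln (num_lt n (rowo I) x) (num_lt n (colo I) x).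
  by split=> //; apply: (proj2 holds_functionals Hf).
by apply/multiE => //; [lia | apply: Hm; rewrite ?num_lt //; lia].
Qed.

End GoodCells.

(** * Pushes as moves of the game *)

Local Notation pos := 'I_(2 ^ n).
Local Notation row0 := ((2 ^ n).-tuple (idom I)).

Definition dom0 : idom I := enum_val (Ordinal (idom_gt0 I)).
Definition word0 : row0 := nseq_tuple _ dom0.

Definition initial_word (w : row0) : bool := all (mem (iinit I)) w.

Definition encodes l S (ws : seq row0) : Prop :=
  [/\ size ws = l, shaped l (l + n + d) S, single_valued S
    & forall l' (j : pos), l' < l -> tile_at S l' 0 j (rank (tnth (nth word0 ws l') j))].

Lemma shaped_size k y S : shaped k y S -> forall c, c \in S -> size c = W.
Proof. by move=> [Sok _ _] c /Sok[]. Qed.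

Lemma cell_ok_row y c : cell_ok y c -> y <= d + n + n -> rownum c = 0.
Proof.
move=> [_ c0] yn; suff H k o : y < o -> num k o c = 0 by apply: H; rewrite /rowo ltnS.
by elim: k o => //= k IH o oy; rewrite IH ?c0 // ltnW.
Qed.

Lemma encodes_tile l S ws l' i j a : l <= n -> encodes l S ws -> l' < n ->
  tile_at S l' i j a -> l' < l /\ i = 0.
Proof.
move=> ln [_ [Sok _ _] _ _] l'n /tile_atP[c [cS lc _ [<- _]]].
have okc := Sok _ cS; have [_ c0] := okc; split; last by apply: cell_ok_row okc _; lia.
  by rewrite ltnNge; apply/negP => ll'; rewrite c0 // in lc; rewrite /levo; lia.
Qed.

Lemma encode_cat U S t : encode (U ++ S) t = flatten [seq rev c | c <- U] ++ encode S t.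
Proof. by rewrite /encode map_cat flatten_cat catA. Qed.

Definition valid_init l : form AP :=
  valid l.+1 (n - l.+1 + n) (l.+1 + n + d) (good_init I l).

Let init_width l : l < n -> (n - l.+1 + n + (l.+1 + n + d)).+1 = W.
Proof. by rewrite /width; lia. Qed.

Lemma encodes_rcons l S ws U (w : row0) : l < n -> encodes l S ws ->
    shaped l.+1 (l.+1 + n + d) (U ++ S) -> single_valued (U ++ S) ->
    (forall j : pos, tile_at (U ++ S) l 0 j (rank (tnth w j))) ->
  encodes l.+1 (U ++ S) (rcons ws w).
Proof.
move=> ln [szws _ _ tS] sUS svUS tw; split=> //; first by rewrite size_rcons szws.
move=> l' j; rewrite ltnS leq_eqVlt => /predU1P[->|l'l].
  by rewrite nth_rcons szws ltnn eqxx.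
by rewrite nth_rcons szws l'l tile_at_cat tS ?orbT.
Qed.

(** The new word is read off column by column. Facts about earlier words persist because adding
    cells only adds facts, and single-valuedness keeps the push from contradicting them. *)
Lemma valid_init_sound l S ws u : l < n -> encodes l S ws ->
    holds (u ++ encode S false) (valid_init l) ->
  exists U w, [/\ u = flatten [seq rev c | c <- U], initial_word w
    & encodes l.+1 (U ++ S) (rcons ws w)].
Proof.
move=> ln enc; have [_ sS _ _] := enc.
rewrite holds_valid ?init_width //; last exact: shaped_size sS.
move=> [U [uE sUS /(holds_good_init _ (shaped_size sUS) ln)[tot svUS]]].
(* [good_init] leaves the row open, but the zeros required by the shape force it to be 0. *)
have enc' : forall i j y, tile_at (U ++ S) l i j y -> i = 0.
  move=> i j y /tile_atP[c [cS lc _ [<- _]]]; have [Sok _ _] := sUS.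
  by apply: cell_ok_row (Sok _ cS) _; lia.
pose w := [tuple odflt dom0 [pick y in iinit I | tile_at (U ++ S) l 0 j (rank y)] | j < 2 ^ n].
have wP (j : pos) : tnth w j \in iinit I /\ tile_at (U ++ S) l 0 j (rank (tnth w j)).
  rewrite tnth_mktuple; case: pickP => [y /andP[]//|no].
  have [y [i [yD ty]]] := tot _ (ltn_ord j); have := no y.
  by move: (ty); rewrite (enc' _ _ _ ty) => ty0; rewrite yD ty0.
exists U, w; split=> //; first by apply/allP => y /tnthP[j ->]; have [] := wP j.
by apply: encodes_rcons enc _ _ _ => // j; have [] := wP j.
Qed.

(** The word is pushed as one block with a cell of level [l] and row 0 for each column. *)
Lemma valid_init_complete l S ws w : l < n -> encodes l S ws -> initial_word w ->
  exists U, [/\ U != [::], holds (encode (U ++ S) false) (valid_init l)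
    & encodes l.+1 (U ++ S) (rcons ws w)].
Proof.
move=> ln enc /allP wD; have [_ sS svS _] := enc.
pose ks : seq key := [seq (l, 0, nat_of_ord j, rank (tnth w j)) | j : pos <- enum 'I_(2 ^ n)].
have ksP k : k \in ks -> exists j : pos, k = (l, 0, nat_of_ord j, rank (tnth w j)).
  by move=> /mapP[j _ ->]; exists j.
have ks_ok k : k \in ks -> key_ok k.
  by move=> /ksP[j ->]; split; rewrite ?expn_gt0 ?rank_lt.
have ks_mem (j : pos) : (l, 0, nat_of_ord j, rank (tnth w j)) \in ks.
  by apply: map_f; rewrite mem_enum.
(* [FEbar] extends the trace strictly, so the push must be nonempty; there is at least column 0. *)
have ks0 : ks != [::] by apply/eqP => ksE; have := ks_mem (pos_first n); rewrite ksE.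
have U0 : block ks != [::] by case: (ks) ks0.
have sUS : shaped l.+1 (l.+1 + n + d) (block ks ++ S).
  apply: shaped_block sS _ ks0 _; first by rewrite !addSn ltnW.
  by move=> b k /ksP[j ->]; apply: mkcell_ok.
have svUS : single_valued (block ks ++ S).
  move=> l' i j y y' l'n; rewrite !tile_at_cat.
  (* Cells of [S] have levels below [l] and those of the block have level [l], so two facts about
     the same place come from the same part. *)
  have inS z : tile_at S l' i j (rank z) -> l' < l.
    by move/(encodes_tile (ltnW ln) enc l'n)=> [].
  have inU z : tile_at (block ks) l' i j (rank z) ->
      l' = l /\ exists j' : pos, j = j' /\ z = tnth w j'.
    rewrite tile_at_block // ?rank_lt // => /ksP[j' [-> _ -> /rank_inj ->]].
    by split=> //; exists j'.
  case/orP=> [/inU[l'l [j1 [jE ->]]]|ty] /orP[/inU[l'l' [j2 [jE' ->]]]|ty'].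
  - by congr tnth; apply: val_inj; rewrite /= -jE.
  - by have := inS _ ty'; rewrite l'l ltnn.
  - by have := inS _ ty; rewrite l'l' ltnn.
  - exact: svS ty ty'.
have tw (j : pos) : tile_at (block ks ++ S) l 0 j (rank (tnth w j)).
  by rewrite tile_at_cat (proj2 (tile_at_block _ _ ks_ok ln (rank_lt _))).
exists (block ks); split=> //; last exact: encodes_rcons.
rewrite encode_cat /valid_init holds_valid ?init_width //; last exact: shaped_size sS.
exists (block ks); split=> //; apply/(holds_good_init _ (shaped_size sUS) ln); split=> // j jn.
exists (tnth w (Ordinal jn)), 0; split; last exact: tw.
exact/wD/mem_tnth.
Qed.

Definition extends_to_multi_tiling (ws : seq row0) : Prop :=
  exists fs : n.-tuple (grid_map I), multi_tiling fs /\ [seq Init f | f <- fs] = ws.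

Definition valid_final : form AP := valid n.+1 0 (d + n + n + n) (good_final I).

Lemma nth_Init (fs : n.-tuple (grid_map I)) (l : 'I_n) :
  nth word0 [seq Init f | f <- fs] l = Init (tnth fs l).
Proof.
pose f0 : grid_map I := [ffun=> dom0].
by rewrite (nth_map f0) ?size_tuple // (tnth_nth f0).
Qed.

(** Totality yields a type at each place and single-valuedness makes it the only one. In particular
    the facts recorded in [S] agree with the chosen tilings, so that their first rows are the words
    [ws]. *)
Lemma final_ok_multi_tiling U S ws : encodes n S ws -> final_ok (U ++ S) ->
  extends_to_multi_tiling ws.
Proof.
move=> [szws _ _ tS] [sv tot multi acc].
pose fs := [tuple [ffun p : pos * pos => odflt dom0 [pick y | tile_at (U ++ S) l p.1 p.2 (rank y)]] | l < n] : n.-tuple (grid_map I).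
have fsP (l : 'I_n) (i j : pos) : tile_at (U ++ S) l i j (rank (tnth fs l (i, j))).
  rewrite tnth_mktuple ffunE; case: pickP => //= no.
  by have [[y]] := tot _ _ _ (ltn_ord l) (ltn_ord i) (ltn_ord j); rewrite no.
have fsE (l : 'I_n) (i j : pos) y : tile_at (U ++ S) l i j (rank y) -> y = tnth fs l (i, j).
  by move=> ty; apply: sv (ltn_ord l) ty (fsP _ _ _).
exists fs; split.
  split.
  - move=> l; split=> [i j j' jj'|i i' j ii'].
      have [_ [] jN _] := tot _ _ _ (ltn_ord l) (ltn_ord i) (ltn_ord j).
        by have := ltn_ord j'; rewrite jj' jN ltnn.
      by case: jN => -[y y'] []; rewrite -jj' => yH /fsE <- /fsE <-.
    have [_ _ [] iN] := tot _ _ _ (ltn_ord l) (ltn_ord i) (ltn_ord j).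
      by have := ltn_ord i'; rewrite ii' iN ltnn.
    by case: iN => -[y y'] []; rewrite -ii' => yH /fsE <- /fsE <-.
  - move=> l l' ll' i j; have := ltn_ord l'; rewrite ll' => l1n.
    have [[y y'] []] := multi _ _ _ l1n (ltn_ord i) (ltn_ord j).
    by rewrite -ll' => yM /fsE <- /fsE <-.
  - move=> l ln; have [y [i [j [yA iN ty]]]] := acc.
    have [i_n jn] := tile_at_lt ty; exists (Ordinal jn).
    have iE : i = pos_last n by rewrite /= -iN subSS subn0.
    have lE : n.-1 = l by move: ln; lia.
    by rewrite -(fsE _ _ _ y) // -iE -lE.
apply: (@eq_from_nth _ word0); first by rewrite size_map size_tuple szws.
move=> l; rewrite size_map size_tuple => ln.
have -> : nth word0 [seq Init f | f <- fs] l = Init (tnth fs (Ordinal ln)).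
  exact: nth_Init (Ordinal ln).
apply: eq_from_tnth => j; rewrite tnth_mktuple; apply/esym/fsE.
by rewrite tile_at_cat tS ?orbT.
Qed.

(** The push contains one cell for every level, row and column. It is consistent with [S] because
    the tilings start with the words [ws]. *)
Lemma multi_tiling_final_ok S ws : encodes n S ws -> extends_to_multi_tiling ws ->
  exists U, [/\ U != [::], shaped n.+1 (d + n + n + n) (U ++ S) & final_ok (U ++ S)].
Proof.
move=> enc [fs [[til multi acc] initE]]; have [szws sS svS tS] := enc.
pose key_of (k : 'I_n * pos * pos) : key :=
  (nat_of_ord k.1.1, nat_of_ord k.1.2, nat_of_ord k.2, rank (tnth fs k.1.1 (k.1.2, k.2))).
pose ks := [seq key_of k | k <- enum {: 'I_n * pos * pos}].
have ks_ok k : k \in ks -> key_ok k.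
  by move=> /mapP[[[l i] j] _ ->]; split; rewrite /= ?rank_lt.
have ks_mem l i j : key_of (l, i, j) \in ks by rewrite map_f // mem_enum.
have predn : n.-1 < n by rewrite prednK // idim_gt0.
have ks0 : ks != [::].
  by apply/eqP => ksE; have := ks_mem (Ordinal predn) (pos_first n) (pos_first n); rewrite ksE.
have tileP (l : 'I_n) (i j : pos) y :
    tile_at (block ks ++ S) l i j (rank y) <-> y = tnth fs l (i, j).
  rewrite tile_at_cat; split=> [|->]; last first.
    by apply/orP; left; apply/tile_at_block; rewrite ?rank_lt //; apply: ks_mem.
  case/orP=> [|ty].
    move/(tile_at_block _ _ ks_ok (ltn_ord l) (rank_lt y))=> /mapP[[[l' i'] j'] _].
    by case=> /val_inj -> /val_inj -> /val_inj -> /rank_inj.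
  (* A fact coming from [S] lies in row 0 and gives a letter of the word of level [l], which is the
     first row of the tiling. *)
  have [_ i0] := encodes_tile (leqnn n) enc (ltn_ord l) ty.
  rewrite i0 in ty; rewrite (svS _ _ _ _ _ (ltn_ord l) ty (tS _ _ (ltn_ord l))).
  have -> : nth word0 ws l = Init (tnth fs l).
    by rewrite -initE nth_Init.
  by rewrite tnth_mktuple (_ : i = pos_first n) //; apply: val_inj.
have tileN l i j (ln : l < n) (i_n : i < 2 ^ n) (jn : j < 2 ^ n) y :
    tile_at (block ks ++ S) l i j (rank y) <->
    y = tnth fs (Ordinal ln) (Ordinal i_n, Ordinal jn).
  exact: (tileP (Ordinal ln) (Ordinal i_n) (Ordinal jn)).
exists (block ks); split.
- by case: (ks) ks0.
- apply: shaped_block sS _ ks0 _; first by lia.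
  by move=> b [[[l i] j] a] _; apply/cell_ok_full/size_mkcell.
split.
- move=> l i j y y' ln ty; have [i_n jn] := tile_at_lt ty.
  by move: ty; rewrite !(tileN _ _ _ ln i_n jn) => -> ->.
- move=> l i j ln i_n jn; have [hor ver] := til (Ordinal ln); split.
  + by exists (tnth fs (Ordinal ln) (Ordinal i_n, Ordinal jn)); apply/tileN.
  + have [?|jN] := eqVneq j.+1 (2 ^ n); [by left | right].
    have j1n : j.+1 < 2 ^ n by rewrite ltn_neqAle jN.
    have := hor (Ordinal i_n) (Ordinal jn) (Ordinal j1n) erefl.
    by eexists; split; first eassumption; apply/tileN.
  + have [?|iN] := eqVneq i.+1 (2 ^ n); [by left | right].
    have i1n : i.+1 < 2 ^ n by rewrite ltn_neqAle iN.
    have := ver (Ordinal i_n) (Ordinal i1n) (Ordinal jn) erefl.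
    by eexists; split; first eassumption; apply/tileN.
- move=> l i j l1n i_n jn; have ln := ltnW l1n.
  have := multi (Ordinal ln) (Ordinal l1n) erefl (Ordinal i_n) (Ordinal jn).
  by eexists; split; first eassumption; apply/tileN.
- have [|j jA] := acc (Ordinal predn); first by rewrite /= prednK // idim_gt0.
  exists (tnth fs (Ordinal predn) (pos_last n, j)), (nat_of_ord (pos_last n)), (nat_of_ord j); split=> //.
    by rewrite /= subn1 prednK // expn_gt0.
  exact/(tileP (Ordinal predn)).
Qed.

Lemma holds_final S ws : encodes n S ws ->
  holds (encode S false) (FEbar valid_final) <-> extends_to_multi_tiling ws.
Proof.
move=> enc; have [_ sS _ _] := enc; have szS := shaped_size sS.
have E0 : encode S false != [::] by rewrite -size_eq0 size_cat addn1.
have finW : (0 + (d + n + n + n)).+1 = W by [].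
rewrite holds_Ebar //; split.
  move=> [u [_]]; rewrite /valid_final holds_valid // => -[U [_ sUS /(holds_good_final _ (shaped_size sUS)) ok]].
  exact: final_ok_multi_tiling enc ok.
move=> /(multi_tiling_final_ok enc)[U [U0 sUS ok]].
exists (flatten [seq rev c | c <- U]); split.
  case: U U0 sUS {ok} => // c U _ /shaped_size/(_ c); rewrite inE eqxx => /(_ isT) szc.
  by rewrite -size_eq0 /= size_cat size_rev szc.
rewrite /valid_final holds_valid //; exists U; split=> //.
exact/(holds_good_final _ (shaped_size sUS)).
Qed.

(** * Alternation of the quantifiers *)

Lemma alternate_ext (T : Type) (P : pred T) b m (Q Q' : seq T -> Prop) :
  (forall xs, Q xs <-> Q' xs) -> alternate P b m Q <-> alternate P b m Q'.
Proof.
elim: m b Q Q' => [|m IH] b Q Q' QQ' /=; first exact: QQ'.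
have E x b' : alternate P b' m (fun xs => Q (x :: xs)) <-> alternate P b' m (fun xs => Q' (x :: xs)).
  exact: IH.
case: b; split.
- by move=> H x Px; apply/E/H.
- by move=> H x Px; apply/E/H.
- by move=> [x [Px H]]; exists x; split=> //; apply/E.
- by move=> [x [Px H]]; exists x; split=> //; apply/E.
Qed.

(** The part of [game] that starts at round [l], generalised for induction; [game I] is the case
    [l = 0], [m = n]. *)
Definition rounds l m : form AP :=
  foldr (fun l acc => FNot (FEbar (FAnd (valid_init l) acc))) (FEbar valid_final) (iota l m).

(** Each round puts one negation in front of [FEbar], so the polarity follows the parity of [l]: at
    even [l] the formula states that the remaining universal game is won, at odd [l] that the
    remaining existential game is lost. As [n] is even, the final condition occurs positively. *)
Lemma holds_rounds m l S ws : l + m = n -> encodes l S ws ->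
  holds (encode S false) (rounds l m) <->
  let win b := alternate initial_word b m (fun xs => extends_to_multi_tiling (ws ++ xs)) in
  if odd l then ~ win false else win true.
Proof.
elim: m l S ws => [|m IH] l S ws.
  rewrite addn0 => -> enc; rewrite /= (negbTE (idim_even I)) cats0.
  exact: holds_final.
move=> lmn enc; have ln : l < n by lia.
have E0 : encode S false != [::] by rewrite -size_eq0 size_cat addn1.
rewrite -[rounds l m.+1]/(FNot (FEbar (FAnd (valid_init l) (rounds l.+1 m)))).
rewrite holds_not holds_Ebar //.
have ext_alt w b : alternate initial_word b m (fun xs => extends_to_multi_tiling (rcons ws w ++ xs)) <->
    alternate initial_word b m (fun xs => extends_to_multi_tiling (ws ++ w :: xs)).
  by apply: alternate_ext => xs; rewrite cat_rcons.
(* Soundness and completeness of pushes turn the quantifier over words [u] into one over initial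
   words [w]. *)
have step : (exists u, u != [::] /\ holds (u ++ encode S false) (FAnd (valid_init l) (rounds l.+1 m))) <->
    exists w, initial_word w /\
      let win b := alternate initial_word b m (fun xs => extends_to_multi_tiling (ws ++ w :: xs)) in
      if odd l then win true else ~ win false.
  split.
    move=> [u [_]]; rewrite holds_and => -[/(valid_init_sound ln enc)[U [w [-> wD enc']]]].
    rewrite -encode_cat (IH _ _ _ _ enc') ?addSnnS // => win; exists w; split=> //.
    by move: win; rewrite /=; case: (odd l) => /=; rewrite ext_alt.
  move=> [w [wD win]]; have [U [U0 vU enc']] := valid_init_complete ln enc wD.
  exists (flatten [seq rev c | c <- U]); rewrite -encode_cat holds_and; split; last first.
    split=> //; rewrite (IH _ _ _ _ enc') ?addSnnS //.
    by move: win; rewrite /=; case: (odd l) => /=; rewrite ext_alt.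
  case: U U0 enc' {vU} => // c U _ [_ /shaped_size/(_ c)]; rewrite inE eqxx => /(_ isT) szc _ _.
  by rewrite -size_eq0 /= size_cat size_rev szc.
rewrite step /=; case: (odd l) => //; split=> [no w wD|all_w [w [wD]]]; last by apply; apply: all_w.
by apply: NNPP => nw; apply: no; exists w.
Qed.

Lemma models_mc_form : models K (mc_form I) <-> positive I.
Proof.
(* The one-letter trace [[:: false]] encodes the empty list of cells, the position before the first
   round. *)
have enc0 : encodes 0 [::] [::] by split.
have <- : holds (encode [::] false) (game I) <-> positive I := holds_rounds (add0n n) enc0.
split.
  move=> /(_ [:: false]) H; apply: NNPP => nG.
  have : initial_trace (K := K) [:: false] by [].
  move=> /H; rewrite -/(holds _ _) holds_not holds_and; apply; split=> //.
  by apply/holds_reg/matches_any.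
move=> G w /andP[_ /eqP w0]; rewrite -/(holds _ _) holds_not holds_and => -[/holds_reg/matches_any w1].
apply; case: w w0 w1 => [|b [|]] //= [->] _; exact: G.
Qed.

End Semantics.

Theorem theorem4 :
  exists (K : forall I : instance, kripke (AP_of (idom I)))
         (phi : forall I : instance, form (AP_of (idom I))),
    polytime enc_instance
      (fun I => @enc_mc (AP_of (idom I)))
      (fun I => (K I, phi I)) /\
    (forall I : instance, models (K I) (phi I) <-> positive I).
Proof.
exists mc_kripke, mc_form; split; first exact: polytime_reduction.
exact: models_mc_form.
Qed.
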